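(* Suppose that $r'(t)\ge 0$ for all $t$, that $0\le r(t)\le b$ for all $t$, where $b=\sup r(\cdot)$ satisfies $(d-2)<b<2(d-2)$, and that $r(t)/t$ is non-increasing in $t$ for $t>0$. Let $\rho\in(0,1)$ satisfy $\rho\in\left(0,\frac{2(d-2)-b}{2b-2(d-2)}\right]$, let $t_0=D/\rho^2$, and let $s_0$ satisfy $\sqrt{s_0}\ge \sqrt{t_0}+\sqrt{D}=\sqrt{D}\left(1+\frac1\rho\right)$. If $r(t)\le d-2$ for all $t\le s_0$, then the multiple shrinkage estimator $\delta_*$ is minimax.
   Context: One observes $X\sim N_d(\theta,I_d)$ with unknown $\theta\in\mathbf{R}^d$; estimators $\delta$ are judged by the quadratic risk $R(\theta,\delta)=\mathbf{E}_\theta\|\delta(X)-\theta\|^2$, and $\delta$ is minimax if $\sup_\theta R(\theta,\delta)=\inf_{\delta'}\sup_\theta R(\theta,\delta')$ (this minimax value equals $d$, the constant risk of $\delta_{mle}(X)=X$). Let $\pi(\|\theta\|^2)$ be a spherically symmetric (possibly improper) prior density on $\mathbf{R}^d$ with marginal density of $X$, $m_\pi(x)=\int (2\pi)^{-d/2}e^{-\|x-\theta\|^2/2}\,\pi(\|\theta\|^2)\,d\theta$, positive and finite for all $x$ (the constant $2\pi$ in the normal density is the usual number). Write $m_\pi(x)=f_\pi(t)$ with $t=\|x\|^2$, and define $r(t)=-2t f_\pi'(t)/f_\pi(t)$ for $t\ge0$. Let $\theta_1,\ldots,\theta_k\in\mathbf{R}^d$ be different target points and $w_1,\ldots,w_k>0$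 fixed weights with $\sum_{i=1}^k w_i=1$. Put $m_i(x)=f_\pi(\|x-\theta_i\|^2)$, $m_*(x)=\sum_{i=1}^k w_i m_i(x)$, and define the multiple shrinkage estimator $\delta_*(x)=x+\frac{\nabla m_*(x)}{m_*(x)}$. Let $D=\max_{i\ne j}\|\theta_i-\theta_j\|^2$. *)

(* Defs.v *)
From HB Require Import structures.
From mathcomp Require Import all_boot all_order all_algebra.
From mathcomp Require Import all_classical all_reals all_analysis.

Set Implicit Arguments.
Unset Strict Implicit.
Unset Printing Implicit Defensive.

Import Order.TTheory GRing.Theory Num.Theory.
Import numFieldNormedType.Exports.

Local Open Scope classical_set_scope.
Local Open Scope ring_scope.

(* 'rV[R]_n carries the sigma-algebra generated by its coordinates, i.e. the
   Borel sigma-algebra of R^n. *)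
Definition measure_rV_display : measure_display -> measure_display.
Proof. exact. Qed.

Section measurable_rV.
Context (R : realType) (n : nat).

Definition rV_coord (i : 'I_n) (x : 'rV[R]_n) : R := x ord0 i.

Let rV_set0 : g_sigma_preimage rV_coord set0.
Proof. exact: sigma_algebra0. Qed.

Let rV_setC A : g_sigma_preimage rV_coord A -> g_sigma_preimage rV_coord (~` A).
Proof. exact: sigma_algebraC. Qed.

Let rV_bigcup (F : _^nat) : (forall i, g_sigma_preimage rV_coord (F i)) ->
  g_sigma_preimage rV_coord (\bigcup_i (F i)).
Proof. exact: sigma_algebra_bigcup. Qed.

HB.instance Definition _ :=
  @isMeasurable.Build (measure_rV_display default_measure_display)
    'rV[R]_n (g_sigma_preimage rV_coord) rV_set0 rV_setC rV_bigcup.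

End measurable_rV.

Lemma measurable_rV_coord (R : realType) n (i : 'I_n) :
  measurable_fun [set: 'rV[R]_n] (rV_coord i).
Proof.
move=> _ Y mY; rewrite setTI; apply: sub_sigma_algebra => /=.
rewrite -bigcup_seq/=; exists i => /=; first by rewrite mem_index_enum.
by exists Y => //; rewrite setTI.
Qed.

Lemma measurable_fun_rVP d (T : measurableType d) (R : realType) n
    (f : T -> 'rV[R]_n) :
  measurable_fun [set: T] f <->
  forall i, measurable_fun [set: T] (rV_coord i \o f).
Proof.
split=> [mf i|mf].
  by apply: measurableT_comp mf; exact: measurable_rV_coord.
have : g_sigma_preimage (fun i => rV_coord i \o f) `<=` measurable.
  apply: smallest_sub; first exact: sigma_algebra_measurable.
  case: n f mf => [|n] f mf; first by rewrite big_ord0.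
  rewrite -bigcup_mkord_ord; apply: bigcup_sub => i Ii.
  by move=> A [B mB <-]; exact: mf.
by rewrite g_sigma_preimage_comp => sub _ A mA; apply: sub; exists A.
Qed.

Section lebesgue_rV.
Context (R : realType).

Definition rV_cons n (p : R * 'rV[R]_n) : 'rV[R]_n.+1 :=
  \row_i (if unlift ord0 i is Some j then p.2 ord0 j else p.1).

Lemma rV_cons0 n (p : R * 'rV[R]_n) : rV_cons p ord0 ord0 = p.1.
Proof. by rewrite mxE unlift_none. Qed.

Lemma rV_consS n (p : R * 'rV[R]_n) i :
  rV_cons p ord0 (lift ord0 i) = p.2 ord0 i.
Proof. by rewrite mxE liftK. Qed.

Lemma measurable_rV_cons n :
  measurable_fun [set: measurableTypeR R * 'rV[R]_n] (@rV_cons n).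
Proof.
apply/measurable_fun_rVP => i; case: (unliftP ord0 i) => [j ->|->].
  rewrite (_ : _ \o _ = rV_coord j \o snd).
    by apply: measurableT_comp => //; exact: measurable_rV_coord.
  by apply/funext => p; rewrite /= /rV_coord rV_consS.
rewrite (_ : _ \o _ = fst) ?measurable_fst//.
by apply/funext => p; rewrite /= /rV_coord rV_cons0.
Qed.

Section step.
Context (n : nat) (m : {sigma_finite_measure set 'rV[R]_n -> \bar R}).

Definition lebesgue_rV_step : set 'rV[R]_n.+1 -> \bar R :=
  pushforward (lebesgue_measure \x m)%E
    (@rV_cons n : measurableTypeR R * 'rV[R]_n -> 'rV[R]_n.+1).

HB.instance Definition _ :=
  Measure.copy lebesgue_rV_step
   (measure_function_pushforward__canonical__measure_function_Measure
     (lebesgue_measure \x m)%E (@measurable_rV_cons n)).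

Let sigma_finite_step : sigma_finite setT lebesgue_rV_step.
Proof.
have /sigma_finiteP[F [TF ndF Foo]] := sigma_finiteT (@lebesgue_measure R).
have /sigma_finiteP[G [TG ndG Goo]] := sigma_finiteT m.
pose hd (x : 'rV[R]_n.+1) : measurableTypeR R * 'rV[R]_n :=
  (x ord0 ord0, \row_j x ord0 (lift ord0 j)).
have hdK : cancel (@rV_cons n) hd.
  move=> [a v]; congr (_, _); first exact: rV_cons0.
  by apply/rowP => j; rewrite mxE rV_consS.
have mhd : measurable_fun [set: 'rV[R]_n.+1] hd.
  apply/measurable_fun_pairP; split => /=.
    exact: measurable_rV_coord.
  apply/measurable_fun_rVP => j.
  rewrite (_ : _ \o _ = rV_coord (lift ord0 j)); first exact: measurable_rV_coord.
  by apply/funext => x; rewrite /= /rV_coord mxE.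
exists (fun i => hd @^-1` (F i `*` G i)).
  apply/esym/seteqP; split=> // x _.
  have [i _ Fi] : (\bigcup_i F i) (hd x).1 by rewrite -TF.
  have [j _ Gj] : (\bigcup_i G i) (hd x).2 by rewrite -TG.
  exists (maxn i j) => //; split.
    by move: Fi; exact/subsetPset/ndF/leq_maxl.
  by move: Gj; exact/subsetPset/ndG/leq_maxr.
move=> i; have [mF ltF] := Foo i; have [mG ltG] := Goo i; split.
  by rewrite -[X in measurable X]setTI; apply: mhd => //; exact: measurableX.
rewrite /lebesgue_rV_step /pushforward -comp_preimage.
rewrite (_ : hd \o _ = id); last by apply/funext => p; exact: hdK.
by rewrite product_measure1E// lte_mul_pinfty// ge0_fin_numE.
Qed.

HB.instance Definition _ :=
  Measure_isSigmaFinite.Build _ _ _ lebesgue_rV_step sigma_finite_step.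

End step.

(* Lebesgue measure on R^n, as an iterated product measure; lebesgue_rV_box
   checks its value on boxes, which characterizes it. *)
Fixpoint lebesgue_rV n : {sigma_finite_measure set 'rV[R]_n -> \bar R} :=
  match n with
  | 0 => \d_(0 : 'rV[R]_0)
  | n.+1 => lebesgue_rV_step (lebesgue_rV n)
  end.

Lemma lebesgue_rV_box n (A : 'I_n -> set R) :
  (forall i, measurable (A i)) ->
  lebesgue_rV n [set x | forall i, A i (x ord0 i)] =
  (\prod_(i < n) lebesgue_measure (A i))%E.
Proof.
elim: n A => [|n IHn] A mA.
  by rewrite big_ord0 /= diracE mem_set// => -[].
have mB (m : nat) (B : 'I_m -> set R) : (forall i, measurable (B i)) ->
    measurable [set x : 'rV[R]_m | forall i, B i (x ord0 i)].
  move=> mB; rewrite (_ : [set _ | _] =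
      \bigcap_(i in [set: 'I_m]) (rV_coord i @^-1` B i)).
    apply: fin_bigcap_measurable => // i _.
    by rewrite -[X in measurable X]setTI; exact: measurable_rV_coord.
  apply/seteqP; split=> x Bx i; last exact (Bx i I).
  by move=> _; exact (Bx i).
pose A' i := A (lift ord0 i).
have mA' : measurable [set x : 'rV[R]_n | forall i, A' i (x ord0 i)].
  by apply: (mB n A') => i; exact: mA.
rewrite big_ord_recl -(IHn A') => [|i]; last exact: mA.
rewrite -[RHS](@product_measure1E _ _ _ _ _ lebesgue_measure (lebesgue_rV n)
  (A ord0) _ (mA ord0) mA') /=.
rewrite /lebesgue_rV_step /pushforward; congr product_measure1.
apply/seteqP; split=> -[a v] /=.
  move=> Aav; split; first by have := Aav ord0; rewrite rV_cons0.
  by move=> i; have := Aav (lift ord0 i); rewrite rV_consS.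
move=> [Aa Av] i; case: (unliftP ord0 i) => [j ->|->].
  by rewrite rV_consS; exact: Av.
by rewrite rV_cons0.
Qed.

End lebesgue_rV.

Section normal_mean_model.
Context (R : realType) (d : nat).
Implicit Types (x theta : 'rV[R]_d) (delta : 'rV[R]_d -> 'rV[R]_d).

(* The canonical norm of 'rV[R]_d is the sup norm, hence this definition of the
   squared Euclidean norm. *)
Definition sqnorm x : R := \sum_i x ord0 i ^+ 2.

Definition std_gauss_pdf x : R :=
  (2 * pi) `^ (- (d%:R / 2)) * expR (- (sqnorm x / 2)).

(* E_theta |delta(X) - theta|^2 for X ~ N_d(theta, I_d), the law of X being given
   by its Lebesgue density. *)
Definition risk theta delta : \bar R :=
  \int[lebesgue_rV R d]_x
    (sqnorm (delta x - theta) * std_gauss_pdf (x - theta))%:E.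

Definition max_risk delta : \bar R :=
  ereal_sup [set risk theta delta | theta in [set: 'rV[R]_d]].

Definition minimax delta : Prop :=
  measurable_fun [set: 'rV[R]_d] delta /\
  max_risk delta =
    ereal_inf [set max_risk delta' |
               delta' in [set delta' | measurable_fun [set: 'rV[R]_d] delta']].

(* The prior density at theta is prior (|theta|^2). *)
Definition marginal (prior : R -> R) x : \bar R :=
  \int[lebesgue_rV R d]_theta
    (std_gauss_pdf (x - theta) * prior (sqnorm theta))%:E.

(* Vector of partial derivatives; only meaningful where m is differentiable. *)
Definition grad (m : 'rV[R]_d -> R) x : 'rV[R]_d :=
  \row_i 'D_(delta_mx ord0 i) m x.

Definition mixture k (f : R -> R) (w : 'I_k -> R) (target : 'I_k -> 'rV[R]_d) x
  : R := \sum_i w i * f (sqnorm (x - target i)).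

Definition multiple_shrinkage k f w (target : 'I_k -> 'rV[R]_d) x : 'rV[R]_d :=
  x + (mixture f w target x)^-1 *: grad (mixture f w target) x.

(* For k <= 1 there is no pair i != j, and the value is then 0. *)
Definition max_sqdist k (target : 'I_k -> 'rV[R]_d) : R :=
  \big[Num.max/0]_(p : 'I_k * 'I_k | p.1 != p.2)
     sqnorm (target p.1 - target p.2).

End normal_mean_model.

(* f only matters on [0, +oo[; at t = 0 the factor t makes the value 0
   whatever f does on the negative half-line. *)
Definition shrinkage_ratio (R : realType) (f : R -> R) (t : R) : R :=
  - 2 * t * derive1 f t / f t.

(* Main.v *)
(* Upper bound. Put r_i = r(t_i) and v_i = r_i / t_i with t_i = |x - theta_i|^2,
   and let p_i be proportional to w_i f(t_i). The score g = grad (log m_star) is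
   - sum_i p_i v_i (x - theta_i). Since f(s^2) exp (s^2 / 2) is an even Laplace
   transform in s, it is nondecreasing for s >= 0, that is, v <= 1; with r <= b
   this makes g bounded, and with v' <= 0 and Jensen's inequality it gives
   d_j g_j >= -1. Hence Stein's identity holds on every line that misses the
   targets, in the form
     E [(e_j + g_j)^2 + e_j^2] = E [2 (d_j g_j + 1) + g_j^2],  e_j = X_j - theta_j,
   whose two sides are integrals of nonnegative functions. Summing over j, the
   risk is at most d as soon as
     2 sum_i p_i v_i (r_i - (d - 2)) <= |sum_i p_i v_i (x - theta_i)|^2.
   If all t_i <= s0 the left-hand side is nonpositive. Otherwise t_i >= D / rho^2
   for all i; Chebyshev's sum inequality (r is nondecreasing, v nonincreasing)
   bounds the left-hand side by 2 A (S - (d - 2)) with A = sum_i p_i v_i and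
   S = sum_i p_i r_i, and the right-hand side is at least A S - A^2 D / 2, so that
   b (1 + rho^2 / 2) <= 2 (d - 2) suffices.

   Lower bound. The maximal risk dominates the Bayes risk under the prior
   N(0, tau I), which is at least d tau / (1 + tau), and tau is arbitrary. *)

Require Import Defs.
From HB Require Import structures.
From mathcomp Require Import all_boot all_order all_algebra.
From mathcomp Require Import all_classical all_reals all_analysis.
From mathcomp Require Import measurable_realfun.
From mathcomp Require Import ring lra.

Set Implicit Arguments.
Unset Strict Implicit.
Unset Printing Implicit Defensive.

Import Order.TTheory GRing.Theory Num.Theory.
Import numFieldNormedType.Exports.

Local Open Scope classical_set_scope.
Local Open Scope ring_scope.

(** * Slicing Lebesgue measure along a coordinate *)

Section slices.
Context {R : realType}.

(** [rV_cons] is the case [j = ord0]. An arbitrary position is wanted because Stein's identity is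
    applied along every coordinate axis. *)
Definition rV_insert n (j : 'I_n.+1) (s : R) (y : 'rV[R]_n) : 'rV[R]_n.+1 :=
  \row_i (if unlift j i is Some i' then y ord0 i' else s).

Lemma rV_insert_at n (j : 'I_n.+1) s (y : 'rV[R]_n) :
  rV_insert j s y ord0 j = s.
Proof. by rewrite mxE unlift_none. Qed.

Lemma rV_insert_lift n (j : 'I_n.+1) s (y : 'rV[R]_n) i :
  rV_insert j s y ord0 (lift j i) = y ord0 i.
Proof. by rewrite mxE liftK. Qed.

Lemma measurable_rV_insert n (j : 'I_n.+1) :
  measurable_fun [set: measurableTypeR R * 'rV[R]_n]
    (fun p => rV_insert j p.1 p.2).
Proof.
apply/measurable_fun_rVP => i; case: (unliftP j i) => [j' ->|->].
  rewrite (_ : _ \o _ = @rV_coord R n j' \o snd).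
    by apply: measurableT_comp => //; exact: measurable_rV_coord.
  by apply/funext => p; rewrite /= /rV_coord rV_insert_lift.
rewrite (_ : _ \o _ = fst) ?measurable_fst//.
by apply/funext => p; rewrite /= /rV_coord rV_insert_at.
Qed.

(** The exchange on which the induction of [integral_rV_slice] rests. *)
Lemma rV_cons_insert n (j : 'I_n.+1) (s a : R) (z : 'rV[R]_n) :
  rV_cons (a, rV_insert j s z) = rV_insert (lift ord0 j) s (rV_cons (a, z)).
Proof.
apply/rowP => i; case: (unliftP ord0 i) => [i1 ->|->].
  rewrite rV_consS; case: (unliftP j i1) => [i2 ->|->].
    have -> : lift ord0 (lift j i2) = lift (lift ord0 j) (lift ord0 i2).
      by apply: val_inj; rewrite /= /bump !leq0n !add1n ltnS addnS.
    by rewrite !rV_insert_lift.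
  by rewrite !rV_insert_at.
rewrite rV_cons0.
have -> : ord0 = lift (lift ord0 j) ord0 :> 'I_n.+2 by apply: val_inj.
by rewrite rV_insert_lift rV_cons0.
Qed.

Local Open Scope ereal_scope.

Lemma integral_rV_cons n (F : 'rV[R]_n.+1 -> \bar R) :
  measurable_fun [set: 'rV[R]_n.+1] F -> (forall x, 0 <= F x) ->
  \int[lebesgue_rV R n.+1]_x F x =
  \int[lebesgue_measure]_s \int[lebesgue_rV R n]_y F (rV_cons (s, y)).
Proof.
move=> mF F0.
rewrite (@ge0_integral_pushforward _ _ _ _ _ _ (@measurable_rV_cons R n)
  (lebesgue_measure \x lebesgue_rV R n) setT)//.
rewrite preimage_setT fubini_tonelli1//.
  by apply: measurableT_comp => //; exact: measurable_rV_cons.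
by move=> p; exact: F0.
Qed.

Lemma integral_rV_cons_swap n (F : 'rV[R]_n.+1 -> \bar R) :
  measurable_fun [set: 'rV[R]_n.+1] F -> (forall x, 0 <= F x) ->
  \int[lebesgue_rV R n.+1]_x F x =
  \int[lebesgue_rV R n]_y \int[lebesgue_measure]_s F (rV_cons (s, y)).
Proof.
move=> mF F0; rewrite integral_rV_cons//.
apply: (fubini_tonelli
  (fun p : measurableTypeR R * 'rV[R]_n => F (rV_cons p))) => //.
by apply: measurableT_comp => //; exact: measurable_rV_cons.
Qed.

(** The measure is built by splitting off coordinate 0, so [j = ord0] is Tonelli's theorem. For
    [j = lift ord0 j'] both sides are first integrated over coordinate 0, and the induction
    hypothesis handles the rest. *)
Lemma integral_rV_slice n (j : 'I_n.+1) (F : 'rV[R]_n.+1 -> \bar R) :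
  measurable_fun [set: 'rV[R]_n.+1] F -> (forall x, 0 <= F x) ->
  \int[lebesgue_rV R n.+1]_x F x =
  \int[lebesgue_rV R n]_y \int[lebesgue_measure]_s F (rV_insert j s y).
Proof.
move=> mF F0; elim: n j F mF F0 => [|n IHn] j F mF F0.
all: have [->|[j' jE]] : j = ord0 \/ exists j', j = lift ord0 j' by
  case: (unliftP ord0 j) => [j' ->|->]; [right; exists j'|left].
1,3: exact: integral_rV_cons_swap.
  by case: (j').
have mG : measurable_fun [set: 'rV[R]_n.+1]
    (fun y => \int[lebesgue_measure]_s F (rV_insert j s y)).
  apply: (measurable_fun_fubini_tonelli_G
    (fun p : measurableTypeR R * _ => F (rV_insert j p.1 p.2))) => //.
  by apply: measurableT_comp => //; exact: measurable_rV_insert.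
rewrite !integral_rV_cons//; last by move=> y; exact: integral_ge0.
apply: eq_integral => a _.
transitivity (\int[lebesgue_rV R n]_z \int[lebesgue_measure]_s
    F (rV_cons (a, rV_insert j' s z))).
  apply: (IHn j' (fun x => F (rV_cons (a, x)))) => //.
  apply: measurableT_comp => //.
  apply: (measurableT_comp (@measurable_rV_cons R n.+1)).
  exact: measurable_pair1.
by apply: eq_integral => z _; apply: eq_integral => s _;
  rewrite rV_cons_insert jE.
Qed.

(** A point is a box with degenerate sides. The dimension has to be positive: in dimension 0 the
    measure is a Dirac mass. *)
Lemma lebesgue_rV_set1 n (x : 'rV[R]_n.+1) : lebesgue_rV R n.+1 [set x] = 0.
Proof.
transitivity (\prod_(i < n.+1) lebesgue_measure [set x ord0 i]).
  rewrite -(@lebesgue_rV_box _ _ (fun i => [set x ord0 i]))//.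
  congr (lebesgue_rV R n.+1 _); apply/seteqP; split=> [y -> //|y /= xy].
  by apply/rowP => i; exact: xy.
by rewrite big_ord_recl lebesgue_measure_set1 mul0e.
Qed.

Lemma measurable_rV_set1 n (x : 'rV[R]_n) : measurable [set x].
Proof.
rewrite (_ : [set x] = \bigcap_(i in [set: 'I_n]) (rV_coord i @^-1` [set x ord0 i])).
  apply: fin_bigcap_measurable => // i _.
  by rewrite -[X in measurable X]setTI; exact: measurable_rV_coord.
apply/seteqP; split=> [y -> //|y /= xy]; apply/rowP => i.
exact: xy.
Qed.

End slices.

(** * Stein's identity on the line *)

Section derivatives.
Context {R : realType}.
Implicit Types (f g : R -> R) (x a b : R).

(** The pattern used throughout: a derivative is assembled with the rules below, and its value is
    then identified with the wanted one by [ring] or [field]. *)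
Lemma drv_eq f x a b : is_derive x 1 f a -> a = b -> is_derive x 1 f b.
Proof. by move=> h <-. Qed.

Lemma drv_ext f g x a : (forall z, f z = g z) ->
  is_derive x 1 f a -> is_derive x 1 g a.
Proof. by move=> /funext ->. Qed.

Lemma drv_cst x (c : R) : is_derive x 1 (fun=> c) 0.
Proof. exact: is_derive_cst. Qed.

Lemma drv_id x : is_derive x 1 (fun z : R => z) 1.
Proof. exact: is_derive_id. Qed.

Lemma drvD f g x a b : is_derive x 1 f a -> is_derive x 1 g b ->
  is_derive x 1 (fun z => f z + g z) (a + b).
Proof. by move=> fa gb; exact: is_deriveD. Qed.

Lemma drvN f x a : is_derive x 1 f a -> is_derive x 1 (fun z => - f z) (- a).
Proof. by move=> fa; exact: is_deriveN. Qed.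

Lemma drvB f g x a b : is_derive x 1 f a -> is_derive x 1 g b ->
  is_derive x 1 (fun z => f z - g z) (a - b).
Proof. by move=> fa gb; exact: is_deriveB. Qed.

Lemma drvM f g x a b : is_derive x 1 f a -> is_derive x 1 g b ->
  is_derive x 1 (fun z => f z * g z) (a * g x + f x * b).
Proof.
move=> fa gb; apply: drv_eq (is_deriveM fa gb) _.
by rewrite /GRing.scale /= addrC [g x * a]mulrC.
Qed.

Lemma drvZ f x a (c : R) : is_derive x 1 f a ->
  is_derive x 1 (fun z => c * f z) (c * a).
Proof.
by move=> fa; apply: drv_eq (drvM (drv_cst _ _) fa) _; rewrite mul0r add0r.
Qed.

Lemma drvV f x a : f x != 0 -> is_derive x 1 f a ->
  is_derive x 1 (fun z => (f z)^-1) (- a / f x ^+ 2).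
Proof.
move=> fx0 fa; apply: drv_eq (is_deriveV fx0 fa) _.
by rewrite /GRing.scale /= mulNr mulrC mulNr.
Qed.

Lemma drv_comp f g x a b : is_derive (g x) 1 f a -> is_derive x 1 g b ->
  is_derive x 1 (fun z => f (g z)) (a * b).
Proof.
by move=> fa gb; apply: drv_eq (is_derive1_comp fa gb) _; rewrite mulrC.
Qed.

Lemma drv_sum n (h : 'I_n -> R -> R) x (dh : 'I_n -> R) :
  (forall i, is_derive x 1 (h i) (dh i)) ->
  is_derive x 1 (fun z => \sum_i h i z) (\sum_i dh i).
Proof.
move=> hd; have := @is_derive_sum _ _ _ _ h x 1 dh hd.
by congr is_derive; apply/funext => z; rewrite fct_sumE.
Qed.

Lemma drv_continuous f x a : is_derive x 1 f a -> {for x, continuous f}.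
Proof. by move=> fa; apply/differentiable_continuous/derivable1_diffP. Qed.

End derivatives.

Section stein.
Context {R : realType}.
Variables (m sigma : R).
Hypothesis sigma0 : sigma != 0.
Local Notation phi := (normal_pdf m sigma).

Lemma drv_normal_pdf (x : R) :
  is_derive x 1 phi (- ((x - m) / sigma ^+ 2) * phi x).
Proof.
rewrite normal_pdfE//; apply: (@drv_ext _
  (fun z => normal_peak sigma * expR (- (z - m) ^+ 2 / (sigma ^+ 2 *+ 2)))) => //.
have d1 : is_derive x 1 (fun z => - ((z - m) * (z - m)) / (sigma ^+ 2 *+ 2))
    (- ((x - m) / sigma ^+ 2)).
  have dm := drvB (drv_id x) (drv_cst x m).
  apply: drv_eq (drvM (drvN (drvM dm dm)) (drv_cst x _)) _ => /=.
  by field.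
apply: drv_eq (drvZ _ (drv_comp (is_derive_expR _) d1)) _.
rewrite /normal_fun !expr2; ring.
Qed.

(** Controls the boundary terms of the integration by parts: [exp(- u) <= 1 / u] with
    [u = N ^+ 2 / c], together with [N + C <= N * (1 + |C|)], gives a bound of order [1 / N]. *)
Lemma normal_pdf_tail (C : R) :
  exists K, forall n : nat,
    normal_peak sigma * expR (- (n.+1%:R ^+ 2) / (sigma ^+ 2 *+ 2))
      * (n.+1%:R + C) <= K * n.+1%:R^-1.
Proof.
set c := sigma ^+ 2 *+ 2.
have c0 : 0 < c by rewrite mulrn_wgt0// exprn_even_gt0.
exists (normal_peak sigma * c * (1 + `|C|)) => n.
set N : R := n.+1%:R.
have N1 : 1 <= N by rewrite ler1n.
have N0 : 0 < N by exact: lt_le_trans N1.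
have eN : expR (- N ^+ 2 / c) <= c / N ^+ 2.
  rewrite -[leRHS]invf_div mulNr expRN lef_pV2 ?posrE ?expR_gt0//; last first.
    by rewrite divr_gt0// exprn_gt0.
  by apply: le_trans (expR_ge1Dx _); rewrite lerDr.
have NC : N + C <= N * (1 + `|C|).
  rewrite mulrDr mulr1 lerD2l (le_trans (ler_norm C))//.
  by rewrite ler_peMl.
apply: (@le_trans _ _ (normal_peak sigma * (c / N ^+ 2) * (N * (1 + `|C|)))).
  apply: (@le_trans _ _ (normal_peak sigma * expR (- N ^+ 2 / c)
                           * (N * (1 + `|C|)))).
    by rewrite ler_wpM2l// mulr_ge0 ?normal_peak_ge0 ?expR_ge0.
  rewrite ler_wpM2r ?mulr_ge0 ?addr_ge0// ?(ltW N0)//.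
  by rewrite ler_wpM2l ?normal_peak_ge0.
rewrite le_eqVlt; apply/orP; left; apply/eqP; field.
by rewrite gt_eqF.
Qed.

(* The difference of the two integrands is the derivative of
   2 sigma^2 phi(x) (x - m + g x); both being nonnegative, no integrability of G
   is needed. *)
Lemma normal_stein (g G : R -> R) (C : R) :
  (forall x : R, is_derive x 1 g (G x)) -> continuous G ->
  (forall x, - 1 <= G x) -> (forall x, `|g x| <= C) ->
  (\int[lebesgue_measure]_x (((x - m + g x) ^+ 2 + (x - m) ^+ 2) * phi x)%:E =
   \int[lebesgue_measure]_x
     ((2 * sigma ^+ 2 * (G x + 1) + g x ^+ 2) * phi x)%:E)%E.
Proof.
move=> dg cG G1 gC.
pose A x := (2 * sigma ^+ 2 * (G x + 1) + g x ^+ 2) * phi x.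
pose B x := ((x - m + g x) ^+ 2 + (x - m) ^+ 2) * phi x.
pose P x := 2 * sigma ^+ 2 * (phi x * (x - m + g x)).
have cphi : continuous phi by exact: continuous_normal_pdf.
have cg : continuous g by move=> x; exact: drv_continuous.
have cm : continuous (fun x => x - m).
  by move=> x; apply: cvgB; [exact: cvg_id|exact: cvg_cst].
have cA : continuous A.
  move=> x; apply: cvgM; last exact: cphi.
  apply: cvgD; last by apply: cvgM; exact: cg.
  by apply: cvgM; [exact: cvg_cst|apply: cvgD; [exact: cG|exact: cvg_cst]].
have cB : continuous B.
  move=> x; apply: cvgM; last exact: cphi.
  have cmg : {for x, continuous (fun x => x - m + g x)}.
    by apply: cvgD; [exact: cm|exact: cg].
  by apply: cvgD; apply: cvgM; solve [exact: cmg|exact: cm].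
have dP (x : R) : is_derive x 1 P (A x - B x).
  have dm := drvB (drv_id x) (drv_cst x m).
  apply: drv_eq (drvZ _ (drvM (drv_normal_pdf x) (drvD dm (dg x)))) _ => /=.
  rewrite /A /B; field.
  done.
have A0 x : 0 <= A x.
  apply: mulr_ge0; last exact: normal_pdf_ge0.
  apply: addr_ge0; last exact: sqr_ge0.
  by apply: mulr_ge0; [rewrite mulr_ge0// sqr_ge0|have := G1 x; lra].
have B0 x : 0 <= B x.
  apply: mulr_ge0; last exact: normal_pdf_ge0.
  by apply: addr_ge0; exact: sqr_ge0.
pose I (n : nat) : set R := [set` `[m - n%:R, m + n%:R]].
have UI : \bigcup_n I n = setT.
  apply/seteqP; split => // x _.
  exists (Num.truncn `|x - m|).+1 => //=; rewrite /I /= in_itv/=.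
  have : `|x - m| < (Num.truncn `|x - m|).+1%:R by exact: truncnS_gt.
  by rewrite ltr_norml => /andP[? ?]; apply/andP; split; lra.
(* Monotone convergence along the intervals [I n], which exhaust the line. *)
have lim (F : R -> R) : continuous F -> (forall x, 0 <= F x) ->
    (\int[lebesgue_measure]_(x in I n) (F x)%:E @[n --> \oo] -->
     \int[lebesgue_measure]_x (F x)%:E)%E.
  move=> cF F0; rewrite -UI; apply: ge0_nondecreasing_set_cvg_integral.
  - move=> a b ab; apply/subsetPset; apply: subset_itv; rewrite bnd_simp.
      by rewrite lerD2l lerN2 ler_nat.
    by rewrite lerD2l ler_nat.
  - by move=> n; exact: measurable_itv.
  - move=> n; apply/measurable_EFinP; apply: measurable_funTS.
    exact: continuous_measurable_fun.
  - by move=> n x _; rewrite lee_fin.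
(* On a compact interval both integrals are finite and the fundamental theorem of calculus applies.
   The relation is put as a sum because the two limits may be infinite, where a difference would be
   meaningless. *)
have step n : (\int[lebesgue_measure]_(x in I n.+1) (A x)%:E =
    \int[lebesgue_measure]_(x in I n.+1) (B x)%:E
    + (P (m + n.+1%:R) - P (m - n.+1%:R))%:E)%E.
  have iF (F : R -> R) : continuous F ->
      lebesgue_measure.-integrable (I n.+1) (EFin \o F).
    move=> cF; apply: continuous_compact_integrable.
      exact: segment_compact.
    exact: continuous_subspaceT.
  have /= FTC := @continuous_FTC2 _ (fun x => A x - B x) P
     (m - n.+1%:R) (m + n.+1%:R).
  rewrite EFinB -FTC; last 4 first.
  - by rewrite ltrD2l gtrN.
  - apply: continuous_subspaceT => x; apply: cvgB; [exact: cA|exact: cB].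
  - split => [x _| |].
    + by have [] := dP x.
    + by apply: cvg_at_right_filter; apply: drv_continuous.
    + by apply: cvg_at_left_filter; apply: drv_continuous.
  - by move=> x _; rewrite derive1E; apply: derive_val.
  under [X in (_ + X)%E]eq_integral do rewrite EFinB.
  rewrite integralB//; [|exact: iF|exact: iF].
  by rewrite addeC subeK// integrable_fin_num//; exact: iF.
have limP : P (m + n.+1%:R) - P (m - n.+1%:R) @[n --> \oo] --> (0 : R).
  have [K KP] := normal_pdf_tail C.
  have phiE (n : nat) (y : R) : `|y - m| = n%:R ->
      phi y = normal_peak sigma * expR (- (n%:R ^+ 2) / (sigma ^+ 2 *+ 2)).
    by move=> yn; rewrite normal_pdfE// /normal_fun -yn real_normK// num_real.
  have PK (n : nat) (y : R) : `|y - m| = n.+1%:R ->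
      `|P y| <= 2 * sigma ^+ 2 * (K * n.+1%:R^-1).
    have s2 : 0 <= 2 * sigma ^+ 2 by apply: mulr_ge0; [|exact: sqr_ge0].
    move=> yn; rewrite /P normrM ger0_norm//.
    apply: ler_wpM2l => //; apply: le_trans (KP n).
    rewrite normrM ger0_norm ?normal_pdf_ge0// -(phiE _ _ yn).
    rewrite ler_wpM2l ?normal_pdf_ge0// (le_trans (ler_normD _ _))// yn.
    by rewrite lerD2l.
  (* Each of the two endpoints contributes at most [2 * sigma ^+ 2 * K / n.+1]. *)
  have hK : 4 * sigma ^+ 2 * K * n.+1%:R^-1 @[n --> \oo] --> (0 : R).
    rewrite -(mulr0 (4 * sigma ^+ 2 * K)).
    by apply: cvgM; [exact: cvg_cst|exact: cvg_harmonic].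
  apply: norm_cvg0; apply: (@squeeze_cvgr _ _ _ _ (cst 0) _ _ _ _ _ hK) => //.
    apply: nearW => n; rewrite normr_ge0 /=.
    apply: le_trans (ler_normB _ _) _.
    have -> : 4 * sigma ^+ 2 * K * n.+1%:R^-1 =
      2 * sigma ^+ 2 * (K * n.+1%:R^-1) + 2 * sigma ^+ 2 * (K * n.+1%:R^-1).
      by ring.
    apply: lerD; apply: PK.
      by rewrite addrC addKr normr_nat.
    by rewrite addrC addKr normrN normr_nat.
  exact: cvg_cst.
have limA := lim _ cA A0; have limB := lim _ cB B0.
move: limA; rewrite -cvg_shiftS /= => limA.
move: limB; rewrite -cvg_shiftS /= => limB.
have limB' : (\int[lebesgue_measure]_(x in I n.+1) (A x)%:E @[n --> \oo] -->
    \int[lebesgue_measure]_x (B x)%:E)%E.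
  rewrite (_ : (fun n => _) = (fun n =>
      \int[lebesgue_measure]_(x in I n.+1) (B x)%:E +
      (P (m + n.+1%:R) - P (m - n.+1%:R))%:E)%E); last first.
    by apply/funext => n; exact: step.
  rewrite -[X in _ --> X]adde0; apply: cvgeD => //.
  - by rewrite fin_num_adde_defl.
  - by apply: cvg_EFin => //; exact: nearW.
exact: (cvg_unique _ limB' limA).
Qed.

(** Stein's identity with a constant function [h] gives E (X - m + h)^2 + E (X - m)^2 = 2 sigma^2 +
    h^2. The choice [h = 0] yields the variance, and then [h = m - c] yields the claim. *)
Lemma normal_sq_dev (c : R) :
  (\int[lebesgue_measure]_x ((c - x) ^+ 2 * phi x)%:E =
   (sigma ^+ 2 + (m - c) ^+ 2)%:E)%E.
Proof.
have mphi : measurable_fun setT phi by exact: measurable_normal_pdf.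
have stein_cst (h : R) :
    (\int[lebesgue_measure]_x ((x - m + h) ^+ 2 * phi x)%:E +
     \int[lebesgue_measure]_x ((x - m) ^+ 2 * phi x)%:E =
     (2 * sigma ^+ 2 + h ^+ 2)%:E)%E.
  pose sq k x := ((x - m + k) ^+ 2 * phi x)%:E.
  have sq_ge0 k x : [set: R] x -> (0 <= sq k x)%E.
    by move=> _; rewrite lee_fin mulr_ge0 ?sqr_ge0 ?normal_pdf_ge0.
  have msq k : measurable_fun [set: R] (sq k).
    apply/measurable_EFinP; apply: measurable_funM => //.
    apply: measurable_funX; apply: measurable_funD => //.
    exact: measurable_funB.
  transitivity (\int[lebesgue_measure]_x (sq h x + sq 0%R x))%E.
    rewrite (ge0_integralD lebesgue_measure measurableT (sq_ge0 h) (msq h)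
      (sq_ge0 0) (msq 0)).
    by congr (_ + _)%E; apply: eq_integral => x _; rewrite /sq addr0.
  under eq_integral do rewrite /sq addr0 -EFinD -mulrDl.
  have c0 : continuous (fun _ : R => 0 : R) by move=> x; exact: cvg_cst.
  rewrite (normal_stein (fun x : R => drv_cst x h) c0 (C := `|h|))//.
  under eq_integral do rewrite add0r mulr1 EFinM.
  rewrite ge0_integralZl//.
  - by rewrite integral_normal_pdf mule1.
  - exact/measurable_EFinP.
  - by move=> x _; rewrite lee_fin normal_pdf_ge0.
  - by rewrite lee_fin addr_ge0 ?sqr_ge0// mulr_ge0// sqr_ge0.
have := stein_cst 0; under eq_integral do rewrite addr0.
set V := (\int[_]_x _)%E => V2.
have {V2}VE : V = (sigma ^+ 2)%:E.
  have : (0 <= V)%E.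
    by apply: integral_ge0 => x _; rewrite lee_fin mulr_ge0 ?sqr_ge0 ?normal_pdf_ge0.
  move: V2; case: V => [v| |]//; rewrite -EFinD => -[v2] _.
  by congr EFin; lra.
have := stein_cst (m - c); rewrite -/V VE.
under eq_integral => x _.
  rewrite (_ : (x - m + (m - c)) ^+ 2 = (c - x) ^+ 2); last by ring.
  over.
have : (0 <= \int[lebesgue_measure]_x ((c - x) ^+ 2 * phi x)%:E)%E.
  by apply: integral_ge0 => x _; rewrite lee_fin mulr_ge0 ?sqr_ge0 ?normal_pdf_ge0.
case: (\int[_]_x _)%E => [v| |]//; rewrite -EFinD => _ [v2].
by congr EFin; lra.
Qed.

End stein.

(** * The minimax value is at least d *)

Section product_density.
Context {R : realType}.
Local Open Scope ereal_scope.

Lemma measurable_prod_coord n (g : 'I_n -> R -> R) :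
  (forall i, measurable_fun [set: R] (g i)) ->
  measurable_fun [set: 'rV[R]_n] (fun x => (\prod_i g i (x ord0 i))%R).
Proof.
move=> mg; apply: measurable_prod => i _.
by apply: (measurableT_comp (mg i)); exact: measurable_rV_coord.
Qed.

Lemma integral_prod_density n (h : 'I_n -> R -> R) :
  (forall i, measurable_fun [set: R] (h i)) ->
  (forall i x, (0 <= h i x)%R) ->
  (forall i, \int[lebesgue_measure]_x (h i x)%:E = 1) ->
  \int[lebesgue_rV R n]_x (\prod_i h i (x ord0 i))%:E = 1.
Proof.
elim: n h => [|n IHn] h mh h0 h1.
  rewrite integral_dirac ?diracT ?big_ord0 ?mul1e//.
  by apply/measurable_EFinP; exact: measurable_prod_coord.
rewrite (integral_rV_slice ord0)/=; last 2 first.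
- by apply/measurable_EFinP; exact: measurable_prod_coord.
- by move=> x; rewrite lee_fin prodr_ge0.
rewrite -[RHS](IHn (fun i => h (lift ord0 i)))//.
apply: eq_integral => y _.
transitivity (\int[lebesgue_measure]_s
    ((\prod_i h (lift ord0 i) (y ord0 i))%:E * (h ord0 s)%:E)).
  apply: eq_integral => s _; rewrite big_ord_recl rV_insert_at mulrC EFinM.
  by congr (_%:E * _); apply: eq_bigr => i _; rewrite rV_insert_lift.
rewrite ge0_integralZl//.
- by rewrite h1 mule1.
- by apply/measurable_EFinP; exact: mh.
- by move=> s _; rewrite lee_fin.
- by rewrite lee_fin prodr_ge0.
Qed.

(** Slicing along [j] separates a product density in the remaining coordinates, which integrates to
    1. *)
Lemma integral_prod_density_coord n (h : 'I_n -> R -> R) (j : 'I_n) (F : R -> R) :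
  (forall i, measurable_fun [set: R] (h i)) ->
  (forall i x, (0 <= h i x)%R) ->
  (forall i, \int[lebesgue_measure]_x (h i x)%:E = 1) ->
  measurable_fun [set: R] F -> (forall x, (0 <= F x)%R) ->
  \int[lebesgue_rV R n]_x (F (x ord0 j) * \prod_i h i (x ord0 i))%:E =
  \int[lebesgue_measure]_s (F s * h j s)%:E.
Proof.
case: n h j => [|n] h j mh h0 h1 mF F0; first by case: j.
rewrite (integral_rV_slice j)/=; last 2 first.
- apply/measurable_EFinP; apply: measurable_funM; last exact: measurable_prod_coord.
  by apply: (measurableT_comp mF); exact: measurable_rV_coord.
- by move=> x; rewrite lee_fin mulr_ge0// prodr_ge0.
transitivity (\int[lebesgue_rV R n]_y
   ((\int[lebesgue_measure]_s (F s * h j s)%:E) *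
    (\prod_i h (lift j i) (y ord0 i))%:E)).
  apply: eq_integral => y _.
  transitivity (\int[lebesgue_measure]_s
      ((\prod_i h (lift j i) (y ord0 i))%:E * (F s * h j s)%:E)).
    apply: eq_integral => s _.
    rewrite (bigD1_ord j)//= rV_insert_at mulrA mulrC EFinM.
    by congr (_%:E * _); apply: eq_bigr => i _; rewrite rV_insert_lift.
  rewrite ge0_integralZl//.
  - by rewrite muleC.
  - by apply/measurable_EFinP; apply: measurable_funM => //; exact: mh.
  - by move=> s _; rewrite lee_fin mulr_ge0.
  - by rewrite lee_fin prodr_ge0.
rewrite ge0_integralZl//.
- by rewrite (integral_prod_density (h := fun i => h (lift j i)))// mule1.
- by apply/measurable_EFinP;
  exact: (@measurable_prod_coord _ (fun i => h (lift j i))).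
- by move=> s _; rewrite lee_fin prodr_ge0.
- by apply: integral_ge0 => s _; rewrite lee_fin mulr_ge0.
Qed.

End product_density.

(** * Gaussian densities and the normal posterior *)

Section bayes.
Context {R : realType}.

Lemma std_gauss_pdfE d (x m : 'rV[R]_d) :
  std_gauss_pdf (x - m) = \prod_i normal_pdf (m ord0 i) 1 (x ord0 i).
Proof.
under eq_bigr do rewrite normal_pdfE//.
rewrite big_split /= /std_gauss_pdf; congr (_ * _).
  rewrite prodr_const card_ord /normal_peak expr1n mul1r -(mulr_natl pi 2).
  rewrite powRN exprVn -powR12_sqrt ?mulr_ge0 ?pi_ge0//.
  by rewrite -powR_mulrn ?powR_ge0// -powRrM [2^-1 * _]mulrC.
rewrite -expR_sum; congr expR.
rewrite /sqnorm mulr_suml -sumrN; apply: eq_bigr => i _.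
by rewrite !mxE expr1n mulNr.
Qed.

Lemma std_gauss_pdf_ge0 d (x : 'rV[R]_d) : 0 <= std_gauss_pdf x.
Proof. by rewrite mulr_ge0 ?powR_ge0 ?expR_ge0. Qed.

Lemma measurable_std_gauss_pdf d (m : 'rV[R]_d) :
  measurable_fun [set: 'rV[R]_d] (fun x => std_gauss_pdf (x - m)).
Proof.
under eq_fun do rewrite std_gauss_pdfE.
apply: (measurable_prod_coord (g := fun i => normal_pdf (m ord0 i) 1)) => i.
exact: measurable_normal_pdf.
Qed.

(** Normal conjugacy, by completing the square in [t]: likelihood times prior N(0, v) is the
    marginal N(0, 1 + v) times the posterior. The scale parameter of [normal_pdf] is a standard
    deviation, hence the square roots. *)
Lemma normal_pdf_posterior (v x t : R) : 0 < v ->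
  normal_pdf t 1 x * normal_pdf 0 (Num.sqrt v) t =
  normal_pdf 0 (Num.sqrt (1 + v)) x *
  normal_pdf (v / (1 + v) * x) (Num.sqrt (v / (1 + v))) t.
Proof.
move=> v0; have v1 : 0 < 1 + v by lra.
have a0 : 0 < v / (1 + v) by rewrite divr_gt0.
have s0 (u : R) : 0 < u -> Num.sqrt u != 0.
  by move=> u0; rewrite gt_eqF// sqrtr_gt0.
rewrite !normal_pdfE ?s0// /normal_fun /normal_peak.
rewrite !sqr_sqrtr ?(ltW v0) ?(ltW v1) ?(ltW a0)//.
rewrite mulrACA [RHS]mulrACA -!expRD -!invfM; congr (_^-1 * expR _).
  rewrite -!sqrtrM ?mulrn_wge0 ?mulr_ge0 ?pi_ge0 ?(ltW v1)//.
  congr Num.sqrt; field.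
  by rewrite gt_eqF.
field.
by rewrite !gt_eqF.
Qed.

End bayes.

Section minimax_lower_bound.
Context {R : realType} (d : nat).
Local Open Scope ereal_scope.
Implicit Types delta : 'rV[R]_d -> 'rV[R]_d.

Lemma measurable_sqnorm : measurable_fun [set: 'rV[R]_d] (@sqnorm R d).
Proof.
apply: measurable_sum => i; apply: measurable_funX.
exact: measurable_rV_coord.
Qed.

Lemma sqnorm_ge0 (x : 'rV[R]_d) : (0 <= sqnorm x)%R.
Proof. by apply: sumr_ge0 => i _; exact: sqr_ge0. Qed.

Lemma measurable_normal_pdf2 d' (T : measurableType d') (f g : T -> R) (s : R) :
  s != 0%R -> measurable_fun [set: T] f -> measurable_fun [set: T] g ->
  measurable_fun [set: T] (fun z => normal_pdf (f z) s (g z)).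
Proof.
move=> s0 mf mg; under eq_fun do rewrite normal_pdfE//.
apply: measurable_funM => //; rewrite /normal_fun.
apply: measurableT_comp => //=.
apply: measurable_funM => //; apply: measurable_funN; apply: measurable_funX.
exact: measurable_funB.
Qed.

(** The Bayes risk under the prior N(0, v I) is evaluated in both orders of integration: over [x]
    first it is at most [r], over [theta] first it is at least the total posterior variance. *)
Lemma bayes_risk_lower_bound delta (v r : R) :
  measurable_fun [set: 'rV[R]_d] delta -> (0 < v)%R ->
  (forall theta, risk theta delta <= r%:E) ->
  (d%:R * (v / (1 + v)) <= r)%R.
Proof.
move=> mdelta v0 risk_le.
have v1 : (0 < 1 + v)%R by lra.
set a := (v / (1 + v))%R; have a0 : (0 < a)%R by rewrite divr_gt0.
have s0 (u : R) : (0 < u)%R -> Num.sqrt u != 0%R.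
  by move=> u0; rewrite gt_eqF// sqrtr_gt0.
pose prior (t : 'rV[R]_d) := (\prod_i normal_pdf 0 (Num.sqrt v) (t ord0 i))%R.
pose marg (x : 'rV[R]_d) := (\prod_i normal_pdf 0 (Num.sqrt (1 + v)) (x ord0 i))%R.
have prior0 t : (0 <= prior t)%R by apply: prodr_ge0 => i _; exact: normal_pdf_ge0.
have marg0 t : (0 <= marg t)%R by apply: prodr_ge0 => i _; exact: normal_pdf_ge0.
have mprior : measurable_fun setT prior.
  by apply: (measurable_prod_coord
    (g := fun=> normal_pdf 0 (Num.sqrt v))) => i; exact: measurable_normal_pdf.
have mmarg : measurable_fun setT marg.
  by apply: (measurable_prod_coord
    (g := fun=> normal_pdf 0 (Num.sqrt (1 + v)))) => i; exact: measurable_normal_pdf.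
have prior1 : \int[lebesgue_rV R d]_t (prior t)%:E = 1.
  apply: (integral_prod_density
    (h := fun=> normal_pdf 0 (Num.sqrt v))) => [i|i x|i].
  - exact: measurable_normal_pdf.
  - exact: normal_pdf_ge0.
  by apply: integral_normal_pdf; exact: s0.
have marg1 : \int[lebesgue_rV R d]_t (marg t)%:E = 1.
  apply: (integral_prod_density
    (h := fun=> normal_pdf 0 (Num.sqrt (1 + v)))) => [i|i x|i].
  - exact: measurable_normal_pdf.
  - exact: normal_pdf_ge0.
  by apply: integral_normal_pdf; exact: s0.
pose K (p : 'rV[R]_d * 'rV[R]_d) :=
  (sqnorm (delta p.2 - p.1) * std_gauss_pdf (p.2 - p.1) * prior p.1)%:E.
have gauss0 (x : 'rV[R]_d) := std_gauss_pdf_ge0 x.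
have K0 p : 0 <= K p by rewrite lee_fin; apply: mulr_ge0 => //;
  apply: mulr_ge0 => //; exact: sqnorm_ge0.
have mcoord i : measurable_fun [set: 'rV[R]_d * 'rV[R]_d] (fun p => p.1 ord0 i).
  by apply: (measurableT_comp (measurable_rV_coord i)).
have mcoord2 i : measurable_fun [set: 'rV[R]_d * 'rV[R]_d] (fun p => p.2 ord0 i).
  by apply: (measurableT_comp (measurable_rV_coord i)).
pose S (p : 'rV[R]_d * 'rV[R]_d) :=
  (sqnorm (delta p.2 - p.1) * std_gauss_pdf (p.2 - p.1))%R.
have S0 p : (0 <= S p)%R by apply: mulr_ge0 => //; exact: sqnorm_ge0.
have mS : measurable_fun setT S.
  apply: measurable_funM.
    apply: measurable_sum => i; apply: measurable_funX.
    under eq_fun do rewrite !mxE.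
    apply: measurable_funB; last exact: mcoord.
    apply: (measurableT_comp (measurable_rV_coord i)).
    exact: (measurableT_comp mdelta).
  under eq_fun do rewrite std_gauss_pdfE.
  apply: measurable_prod => i _; apply: measurable_normal_pdf2.
  - exact: oner_neq0.
  - exact: mcoord.
  - exact: mcoord2.
have mK : measurable_fun setT K.
  apply/measurable_EFinP; apply: (measurable_funM mS).
  exact: (measurableT_comp mprior).
(* Whatever the estimate [delta x], in each coordinate the posterior mean of the squared error is
   the posterior variance [a] plus a squared bias. *)
have post x : ((d%:R * a) * marg x)%:E <= \int[lebesgue_rV R d]_t K (t, x).
  pose post_pdf i := normal_pdf (a * x ord0 i) (Num.sqrt a).
  have KE t : K (t, x) = (marg x)%:E *
      \sum_(j < d) ((delta x ord0 j - t ord0 j) ^+ 2 *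
        \prod_i post_pdf i (t ord0 i))%:E.
    rewrite /K std_gauss_pdfE /= -mulrA -big_split /=.
    under [X in (_ * X)%R]eq_bigr do rewrite normal_pdf_posterior//.
    rewrite big_split/= sumEFin -EFinM; congr EFin.
    rewrite mulrCA; congr (_ * _)%R.
    rewrite /sqnorm mulr_suml; apply: eq_bigr => j _.
    by rewrite !mxE.
  under eq_integral do rewrite KE.
  have mpost j : measurable_fun [set: 'rV[R]_d] (fun t : 'rV[R]_d =>
      ((delta x ord0 j - t ord0 j) ^+ 2 * \prod_i post_pdf i (t ord0 i))%:E).
    apply/measurable_EFinP; apply: measurable_funM.
      apply: measurable_funX; apply: measurable_funB => //.
      exact: measurable_rV_coord.
    by apply: (measurable_prod_coord (g := post_pdf)) => i;
      exact: measurable_normal_pdf.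
  have post0 j (t : 'rV[R]_d) : 0 <=
      ((delta x ord0 j - t ord0 j) ^+ 2 * \prod_i post_pdf i (t ord0 i))%:E.
    rewrite lee_fin mulr_ge0 ?sqr_ge0// prodr_ge0// => i _.
    exact: normal_pdf_ge0.
  rewrite ge0_integralZl//; last 3 first.
  - exact: emeasurable_sum.
  - by move=> t _; apply: sume_ge0.
  - by rewrite lee_fin.
  rewrite ge0_integral_sum//.
  rewrite mulrC EFinM; apply: lee_pmul.
  - by rewrite lee_fin.
  - by rewrite lee_fin; apply: mulr_ge0 => //; exact: ltW.
  - by [].
  rewrite mulr_natl -[X in (a *+ X)%R]card_ord -sumr_const -sumEFin.
  apply: lee_sum => j _.
  rewrite (@integral_prod_density_coord _ _ post_pdf j
    (fun s => ((delta x ord0 j - s) ^+ 2)%R))//.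
  - rewrite normal_sq_dev ?s0// lee_fin sqr_sqrtr ?(ltW a0)//.
    by rewrite lerDl sqr_ge0.
  - by move=> i; exact: measurable_normal_pdf.
  - by move=> i s; exact: normal_pdf_ge0.
  - by move=> i; apply: integral_normal_pdf; exact: s0.
  - by apply: measurable_funX; exact: measurable_funB.
  - by move=> s; exact: sqr_ge0.
have r0 : (0 <= r)%R.
  rewrite -lee_fin (le_trans _ (risk_le 0%R))//; apply: integral_ge0 => x _.
  by rewrite lee_fin; apply: mulr_ge0 => //; exact: sqnorm_ge0.
have scaleE (c : R) (p : 'rV[R]_d -> R) : (0 <= c)%R ->
    measurable_fun setT p -> (forall x, (0 <= p x)%R) ->
    \int[lebesgue_rV R d]_x (p x)%:E = 1 ->
    \int[lebesgue_rV R d]_x (c * p x)%:E = c%:E.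
  move=> c0 mp p0 p1; under eq_integral do rewrite EFinM.
  rewrite ge0_integralZl ?p1 ?mule1//; first exact/measurable_EFinP.
  by move=> x _; rewrite lee_fin.
have da0 : (0 <= d%:R * a)%R by apply: mulr_ge0 => //; exact: ltW.
(* Both constants are written as integrals against the probability densities [marg] and [prior], so
   that pointwise comparisons with the inner integrals of [K] suffice. *)
rewrite -lee_fin -(scaleE _ _ da0 mmarg marg0 marg1).
rewrite -(scaleE _ _ r0 mprior prior0 prior1).
apply: (@le_trans _ _ (\int[lebesgue_rV R d]_x \int[lebesgue_rV R d]_t K (t, x))).
  apply: ge0_le_integral => //.
  - by move=> x _; rewrite lee_fin; apply: mulr_ge0.
  - by apply/measurable_EFinP; exact: measurable_funM.
  - exact: (measurable_fun_fubini_tonelli_G K).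
rewrite -(fubini_tonelli K mK K0).
apply: ge0_le_integral => //.
- by move=> t _; exact: integral_ge0.
- exact: (measurable_fun_fubini_tonelli_F K).
- by apply/measurable_EFinP; exact: measurable_funM.
move=> t _; rewrite mulrC EFinM.
apply: (@le_trans _ _ ((prior t)%:E * risk t delta)); last first.
  apply: lee_pmul; [by rewrite lee_fin| |by []|exact: risk_le].
  apply: integral_ge0 => x _.
  by rewrite lee_fin; apply: mulr_ge0 => //; exact: sqnorm_ge0.
rewrite /risk -ge0_integralZl//.
- rewrite le_eqVlt; apply/orP; left; apply/eqP; apply: eq_integral => x _.
  by rewrite /K /= mulrC EFinM.
- apply/measurable_EFinP; apply: (measurableT_comp (f := S) mS (g := pair t)).
  exact: measurable_pair1.
- by move=> x _; rewrite lee_fin; exact: (S0 (t, x)).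
- by rewrite lee_fin.
Qed.

Lemma max_risk_ge delta : measurable_fun [set: 'rV[R]_d] delta ->
  d%:R%:E <= max_risk delta.
Proof.
move=> mdelta.
have risk_le theta : risk theta delta <= max_risk delta.
  by apply: ereal_sup_ubound; exists theta.
have max0 : 0 <= max_risk delta.
  apply: le_trans (risk_le 0%R); apply: integral_ge0 => x _; rewrite lee_fin.
  by rewrite mulr_ge0 ?sqnorm_ge0 ?std_gauss_pdf_ge0.
case: (max_risk delta) risk_le max0 => [r| |] risk_le max0; last by [].
  rewrite lee_fin; apply/ler_addgt0Pr => e e0.
  (* Dimension 0 is set apart because the prior variance [d / e] chosen next must be positive. *)
  have [->|d0] := eqVneq d 0%N; first by rewrite addr_ge0// ltW.
  have dgt0 : (0 < d%:R :> R)%R by rewrite ltr0n lt0n.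
  (* With [v = d / e] the Bayes bound falls short of [d] by [e * (d / (e + d))], hence by at most
     [e]. *)
  have v0 : (0 < d%:R / e)%R by rewrite divr_gt0.
  have := bayes_risk_lower_bound mdelta v0 risk_le.
  have -> : (d%:R * (d%:R / e / (1 + d%:R / e)) = d%:R - e * (d%:R / (e + d%:R)))%R.
    by field; rewrite !gt_eqF// addr_gt0.
  have : (e * (d%:R / (e + d%:R)) <= e)%R.
    rewrite ler_piMr ?(ltW e0)// ler_pdivrMr ?addr_gt0//.
    by rewrite mul1r lerDr ltW.
  lra.
by rewrite leey.
Qed.

End minimax_lower_bound.

(** * The marginal as a Laplace transform *)

Section laplace.
Context {R : realType} {d : measure_display} {T : measurableType d}
  (mu : {measure set T -> \bar R}) (X K : T -> R).
Hypothesis mX : measurable_fun [set: T] X.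
Hypothesis mK : measurable_fun [set: T] K.
Hypothesis K0 : forall x, 0 <= K x.
Hypothesis Kfin : forall s, (\int[mu]_x (expR (s * X x) * K x)%:E < +oo)%E.

Let kernel n s x := X x ^+ n * expR (s * X x) * K x.

Definition laplace_moment n s : R := \int[mu]_x kernel n s x.

Let measurable_kernel n s : measurable_fun [set: T] (kernel n s).
Proof.
apply: measurable_funM => //; apply: measurable_funM; first exact: measurable_funX.
by apply: measurableT_comp => //; exact: measurable_funM.
Qed.

(** Dominates [exp(c * |X|) * K] and is integrable by [Kfin] at [c] and at [- c]. *)
Let envelope c x := (expR (c * X x) + expR (- c * X x)) * K x.

Let envelope_ge0 c x : 0 <= envelope c x.
Proof. by rewrite mulr_ge0// addr_ge0 ?expR_ge0. Qed.

Let integrable_expR c : mu.-integrable setT (fun x => (expR (c * X x) * K x)%:E).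
Proof.
apply/integrableP; split.
  apply/measurable_EFinP; apply: measurable_funM => //.
  by apply: measurableT_comp => //; exact: measurable_funM.
apply: le_lt_trans (Kfin c); rewrite le_eqVlt; apply/orP; left; apply/eqP.
by apply: eq_integral => x _; rewrite gee0_abs// lee_fin mulr_ge0 ?expR_ge0.
Qed.

Let integrable_envelope c : mu.-integrable setT (EFin \o envelope c).
Proof.
rewrite (_ : _ \o _ = fun x => (expR (c * X x) * K x)%:E +
    (expR (- c * X x) * K x)%:E)%E; last first.
  by apply/funext => x /=; rewrite -EFinD -mulrDl.
by apply: integrableD => //; exact: integrable_expR.
Qed.

(** Since [|X| ^ n <= exp(n * |X|)], the polynomial factor costs only an increase of the exponent by
    [n]. *)
Let kernel_le n (s c : R) x : `|s| + n%:R <= c -> `|kernel n s x| <= envelope c x.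
Proof.
move=> sc; rewrite /kernel /envelope normrM (ger0_norm (K0 x)) ler_wpM2r//.
rewrite normrM (ger0_norm (expR_ge0 _)).
apply: (@le_trans _ _ (expR (c * `|X x|))); last first.
  have [x0|x0] := lerP 0 (X x).
    by rewrite ger0_norm// lerDl expR_ge0.
  by rewrite ltr0_norm// mulrN mulNr lerDr expR_ge0.
apply: (@le_trans _ _ (expR (n%:R * `|X x|) * expR (`|s| * `|X x|))).
  apply: ler_pM; rewrite ?expR_ge0//.
    rewrite normrX expRM_natl lerXn2r ?nnegrE ?expR_ge0//.
    by apply: le_trans (expR_ge1Dx _); rewrite lerDr.
  by rewrite ler_expR -normrM ler_norm.
by rewrite -expRD ler_expR -mulrDl ler_wpM2r// addrC.
Qed.

Let integrable_kernel n s : mu.-integrable setT (EFin \o kernel n s).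
Proof.
apply: (le_integrable measurableT _ _ (integrable_envelope (`|s| + n%:R))).
  exact/measurable_EFinP.
move=> x _ /=; rewrite lee_fin (ger0_norm (envelope_ge0 _ _)).
exact: kernel_le.
Qed.

Let drv_kernel n x (s : R) : is_derive s 1 (kernel n ^~ x) (kernel n.+1 s x).
Proof.
rewrite /kernel; have d1 := drvM (drv_id s) (drv_cst s (X x)).
have := drvM (drvZ (X x ^+ n) (drv_comp (is_derive_expR _) d1)) (drv_cst s (K x)).
move/drv_eq; apply; rewrite exprS; ring.
Qed.

Lemma drv_laplace_moment n (s : R) :
  is_derive s 1 (laplace_moment n) (laplace_moment n.+1 s).
Proof.
(* The 1 is the radius of the interval around [s] on which the derivative is dominated; [n.+1] is
   the order of the differentiated kernel. *)
pose c := `|s| + 1 + n.+1%:R.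
have sI : [set` `]s - 1, s + 1[] s by rewrite /= in_itv/=; lra.
have dE t x : partial1of2 (kernel n) t x = kernel n.+1 t x.
  by rewrite partial1of2E; apply: derive_val.
have H1 t x : [set` `]s - 1, s + 1[] t -> [set: T] x -> derivable (kernel n ^~ x) t 1.
  by move=> _ _; have [] := drv_kernel n x t.
have H2 t x : [set` `]s - 1, s + 1[] t -> [set: T] x ->
    `|partial1of2 (kernel n) t x| <= envelope c x.
  rewrite /= in_itv/= => /andP[t1 t2] _; rewrite dE; apply: kernel_le.
  rewrite lerD2r; have := ler_normD s (t - s); rewrite addrC subrK.
  have : `|t - s| <= 1 by rewrite ler_norml; lra.
  lra.
have int t : [set` `]s - 1, s + 1[] t -> mu.-integrable setT (EFin \o kernel n t).
  by [].
apply: DeriveDef.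
  exact: (derivable_under_integral measurableT sI int H1 (envelope_ge0 c)
    (integrable_envelope c) H2).
rewrite -derive1E (differentiation_under_integral measurableT sI int H1
  (envelope_ge0 c) (integrable_envelope c) H2).
by apply: eq_Rintegral => x _; rewrite dE.
Qed.

Hypothesis even0 : forall s, laplace_moment 0 (- s) = laplace_moment 0 s.

(** Obtained by differentiating the evenness relation [even0]. *)
Lemma laplace_moment1_odd (s : R) : laplace_moment 1 (- s) = - laplace_moment 1 s.
Proof.
have d1 : is_derive s 1 (laplace_moment 0) (- laplace_moment 1 (- s)).
  apply: (drv_ext even0).
  have := drv_comp (drv_laplace_moment 0 (- s)) (drvN (drv_id s)).
  by rewrite mulrN1.
have := drv_laplace_moment 0 s => d2.
by rewrite -(@derive_val _ _ _ _ _ _ _ d2) (@derive_val _ _ _ _ _ _ _ d1) opprK.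
Qed.

(* By oddness, 2 L_1(s) is the integral of X (exp(s X) - exp(- s X)) >= 0. *)
Lemma laplace_moment1_ge0 (s : R) : 0 <= s -> 0 <= laplace_moment 1 s.
Proof.
move=> s0; suff : 0 <= laplace_moment 1 s - laplace_moment 1 (- s).
  by rewrite laplace_moment1_odd; lra.
rewrite /laplace_moment -RintegralB//; apply: Rintegral_ge0 => // x _.
rewrite /kernel -mulrBl mulr_ge0// expr1 -mulrBr.
have [x0|x0] := lerP 0 (X x).
  by rewrite mulr_ge0// subr_ge0 ler_expR; nra.
by rewrite mulr_le0 ?(ltW x0)// subr_le0 ler_expR; nra.
Qed.

End laplace.

(** * The marginal density along a coordinate axis *)

Section marginal_transform.
Context {R : realType}.

(* L 0 is the Laplace transform of the first coordinate under the measure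
   exp (- |theta|^2 / 2) prior(|theta|^2) dtheta, up to a constant, and L k is
   its k-th derivative. *)
Lemma marginal_laplace n (prior f : R -> R) :
  measurable_fun (`[0, +oo[ : set R) prior ->
  (forall t, 0 <= t -> 0 <= prior t) ->
  (forall x : 'rV[R]_n.+1, (marginal prior x = (f (sqnorm x))%:E)%E) ->
  exists L : nat -> R -> R,
    [/\ forall k (s : R), is_derive s 1 (L k) (L k.+1 s),
        forall s, f (s ^+ 2) = expR (- (s ^+ 2 / 2)) * L 0 s,
        forall s, 0 <= s -> 0 <= L 1 s &
        L 1 0 = 0].
Proof.
move=> mprior prior0 margE.
pose X (t : 'rV[R]_n.+1) := t ord0 ord0.
pose K (t : 'rV[R]_n.+1) := std_gauss_pdf t * prior (sqnorm t).
have mX : measurable_fun setT X by exact: measurable_rV_coord.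
have mK : measurable_fun setT K.
  apply: measurable_funM.
    have := measurable_std_gauss_pdf (0 : 'rV[R]_n.+1).
    by congr measurable_fun; apply/funext => t; rewrite subr0.
  apply: (measurable_comp _ _ mprior).
  - exact: measurable_itv.
  - by move=> _ [t _ <-]; rewrite /= in_itv/= andbT sqnorm_ge0.
  - exact: measurable_sqnorm.
have K0 t : 0 <= K t.
  by rewrite mulr_ge0 ?prior0 ?sqnorm_ge0 ?std_gauss_pdf_ge0.
have intE s : (\int[lebesgue_rV R n.+1]_t (expR (s * X t) * K t)%:E =
    (expR (s ^+ 2 / 2) * f (s ^+ 2))%:E)%E.
  (* Evaluating the marginal at [s] times the first basis vector and expanding the square in the
     Gaussian density exhibits the Laplace transform at [s]; that the marginal is the real number
     [f (s ^+ 2)] makes this transform finite. *)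
  pose x : 'rV[R]_n.+1 := s *: delta_mx ord0 ord0.
  have xE i : x ord0 i = s *+ (i == ord0) by rewrite !mxE eqxx/= mulr_natr.
  have sqx (t : 'rV[R]_n.+1) : sqnorm (x - t) = s ^+ 2 - 2 * s * X t + sqnorm t.
    rewrite /sqnorm !big_ord_recl !mxE/= addrA; congr (_ + _).
      by rewrite /X; ring.
    by apply: eq_bigr => i _; rewrite !mxE/= mulr0 sub0r sqrrN.
  have sqx0 : sqnorm x = s ^+ 2.
    have := sqx 0; rewrite subr0 /X mxE mulr0 subr0 => ->.
    by rewrite /sqnorm big1 ?addr0// => i _; rewrite mxE expr0n.
  have key t : expR (s * X t) * K t =
      expR (s ^+ 2 / 2) * (std_gauss_pdf (x - t) * prior (sqnorm t)).
    have gaussE : expR (s * X t) * std_gauss_pdf t =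
        expR (s ^+ 2 / 2) * std_gauss_pdf (x - t).
      rewrite /std_gauss_pdf sqx mulrCA [RHS]mulrCA -!expRD.
      by congr (_ * expR _); field.
    by rewrite [LHS]mulrA [RHS]mulrA gaussE.
  under eq_integral do rewrite key EFinM.
  rewrite ge0_integralZl//.
  - by rewrite EFinM -sqx0 -margE.
  - apply/measurable_EFinP.
    rewrite (_ : (fun _ => _) =
        fun t => expR (- (s ^+ 2 / 2)) * (expR (s * X t) * K t)); last first.
      by apply/funext => t; rewrite key mulrA -expRD addNr expR0 mul1r.
    apply: measurable_funM => //; apply: measurable_funM => //.
    by apply: measurableT_comp => //; exact: measurable_funM.
  - move=> t _; rewrite lee_fin.
    by rewrite mulr_ge0 ?prior0 ?sqnorm_ge0 ?std_gauss_pdf_ge0.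
have Kfin s : (\int[lebesgue_rV R n.+1]_t (expR (s * X t) * K t)%:E < +oo)%E.
  by rewrite intE ltry.
pose L := laplace_moment (lebesgue_rV R n.+1) X K.
have L0 s : L 0 s = expR (s ^+ 2 / 2) * f (s ^+ 2).
  rewrite /L /laplace_moment /Rintegral.
  by under eq_integral do rewrite expr0 mul1r; rewrite intE.
have even0 s : L 0 (- s) = L 0 s by rewrite !L0 sqrrN.
exists L; split.
- by move=> k s; exact: drv_laplace_moment.
- by move=> s; rewrite L0 mulrA -expRD addNr expR0 mul1r.
- by move=> s; exact: laplace_moment1_ge0.
- have := laplace_moment1_odd mX mK K0 Kfin even0 0; rewrite oppr0 -/L; lra.
Qed.

End marginal_transform.

(** * The ratio r(t) / t and its derivative *)

Section shrinkage_profile.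
Context {R : realType}.
Variables (f : R -> R) (L : nat -> R -> R).
Hypothesis dL : forall k (s : R), is_derive s 1 (L k) (L k.+1 s).
Hypothesis fE : forall s, f (s ^+ 2) = expR (- (s ^+ 2 / 2)) * L 0 s.
Hypothesis f_gt0 : forall t, 0 <= t -> 0 < f t.
Hypothesis L1_ge0 : forall s, 0 <= s -> 0 <= L 1 s.

(* This is r(t) / t for t > 0. Division by zero gives the value 1 at t = 0, and
   with this value all the bounds used for t > 0 extend to t = 0. *)
Definition shrink_factor t : R :=
  1 - L 1 (Num.sqrt t) / (Num.sqrt t * L 0 (Num.sqrt t)).

(** The derivative of [shrink_factor] through the substitution [s = Num.sqrt t]. Division by zero
    makes it 0 at [t = 0], where the sign conditions wanted of it then hold. *)
Definition shrink_factor' t : R := let s := Num.sqrt t in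
  - ((L 2 s / (s * L 0 s) - L 1 s / (s ^+ 2 * L 0 s) - L 1 s ^+ 2 / (s * L 0 s ^+ 2))
     / (2 * s)).

Lemma laplace_gt0 s : 0 < L 0 s.
Proof.
by have := f_gt0 (sqr_ge0 s); rewrite fE pmulr_rgt0// expR_gt0.
Qed.

Lemma profileE t : 0 <= t -> f t = expR (- (t / 2)) * L 0 (Num.sqrt t).
Proof. by move=> t0; rewrite -{1}(sqr_sqrtr t0) fE sqr_sqrtr. Qed.

Lemma drv_sqrt (t : R) : 0 < t -> is_derive t 1 Num.sqrt (2 * Num.sqrt t)^-1.
Proof. by move=> t0; exact: is_derive1_sqrt. Qed.

(** Logarithmic derivative of the Laplace formula for [f]. That formula is known only at nonnegative
    arguments, hence the passage through a neighbourhood of [t > 0]. *)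
Lemma drv_profile (t : R) : 0 < t ->
  is_derive t 1 f (- (shrink_factor t * f t / 2)).
Proof.
move=> t0; have s0 : 0 < Num.sqrt t by rewrite sqrtr_gt0.
apply: (@near_eq_is_derive _ R R
  (fun u : R => expR (- (u / 2)) * L 0 (Num.sqrt u))).
  near=> u; rewrite profileE//; apply: ltW.
  by near: u; exact: lt_nbhsr.
have d1 := drvN (drvM (drv_id t) (drv_cst t 2^-1)).
have := drvM (drv_comp (is_derive_expR _) d1) (drv_comp (dL 0 _) (drv_sqrt t0)).
move/drv_eq; apply => /=; rewrite /shrink_factor (profileE (ltW t0)).
by field; rewrite !gt_eqF// laplace_gt0.
Unshelve. all: end_near. Qed.

Lemma drv_shrink_factor (t : R) : 0 < t ->
  is_derive t 1 shrink_factor (shrink_factor' t).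
Proof.
move=> t0; have s0 : 0 < Num.sqrt t by rewrite sqrtr_gt0.
have L0 := laplace_gt0 (Num.sqrt t).
have ds := drv_sqrt t0.
have dv := drvV (f := fun t => Num.sqrt t * L 0 (Num.sqrt t))
  (lt0r_neq0 (mulr_gt0 s0 L0)) (drvM ds (drv_comp (dL 0 _) ds)).
have := drvB (drv_cst t 1) (drvM (drv_comp (dL 1 _) ds) dv).
move/drv_eq; apply; rewrite /shrink_factor'.
by field; rewrite !gt_eqF.
Qed.

Lemma shrink_factor_le1 t : 0 < t -> shrink_factor t <= 1.
Proof.
move=> t0; rewrite /shrink_factor gerBl divr_ge0 ?L1_ge0 ?sqrtr_ge0//.
by rewrite mulr_ge0 ?sqrtr_ge0// ltW// laplace_gt0.
Qed.

Lemma shrinkage_ratioE t : 0 < t -> shrinkage_ratio f t = t * shrink_factor t.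
Proof.
move=> t0; rewrite /shrinkage_ratio derive1E.
rewrite (@derive_val _ _ _ _ _ _ _ (drv_profile t0)).
by field; rewrite gt_eqF// f_gt0// ltW.
Qed.

Let continuousL k : continuous (L k).
Proof. by move=> s; exact: (drv_continuous (dL k s)). Qed.

Let measurableL k : measurable_fun [set: R] (fun t => L k (Num.sqrt t)).
Proof.
apply: continuous_measurable_fun => t.
apply: (@continuous_comp _ _ _ Num.sqrt (L k)).
  exact: sqrt_continuous.
exact: continuousL.
Qed.

(** The inverse is written as the power of exponent -1. Zeros of [g] are allowed, as the
    denominators containing [Num.sqrt t] require. *)
Lemma measurable_inv_ge0 d (T : measurableType d) (g : T -> R) :
  (forall t, 0 <= g t) ->
  measurable_fun [set: T] g -> measurable_fun [set: T] (fun t => (g t)^-1).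
Proof.
move=> g0 mg; under eq_fun do rewrite -powR_inv1//.
exact: (measurableT_comp (measurable_powR _)).
Qed.

Let measurable_sqrt : measurable_fun [set: R] (@Num.sqrt R).
Proof. by apply: continuous_measurable_fun; exact: sqrt_continuous. Qed.

Lemma measurable_shrink_factor : measurable_fun [set: R] shrink_factor.
Proof.
apply: measurable_funB => //; apply: measurable_funM => //.
apply: measurable_inv_ge0; last exact: measurable_funM.
by move=> t; rewrite mulr_ge0 ?sqrtr_ge0// ltW// laplace_gt0.
Qed.

Lemma measurable_shrink_factor' : measurable_fun [set: R] shrink_factor'.
Proof.
have L0 t : 0 <= L 0 (Num.sqrt t) by rewrite ltW// laplace_gt0.
have minv (g h : R -> R) : (forall t, 0 <= g t) -> measurable_fun [set: R] g ->
    measurable_fun [set: R] h -> measurable_fun [set: R] (fun t => h t / g t).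
  by move=> g0 mg mh; apply: measurable_funM => //; exact: measurable_inv_ge0.
apply: measurable_funN; apply: (minv).
- by move=> t; rewrite mulr_ge0 ?sqrtr_ge0.
- exact: measurable_funM.
apply: measurable_funB; first apply: measurable_funB.
- apply: (minv) => // [t|]; first by rewrite mulr_ge0 ?sqrtr_ge0.
  exact: measurable_funM.
- apply: (minv) => // [t|]; first by rewrite mulr_ge0 ?sqr_ge0.
  by apply: measurable_funM => //; exact: measurable_funX.
- apply: (minv) => [t||]; first by rewrite mulr_ge0 ?sqrtr_ge0 ?sqr_ge0.
    by apply: measurable_funM => //; exact: measurable_funX.
  exact: measurable_funX.
Qed.

Lemma continuous_shrink_factor' t : 0 < t -> {for t, continuous shrink_factor'}.
Proof.
move=> t0; have s0 : 0 < Num.sqrt t by rewrite sqrtr_gt0.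
have L0 := laplace_gt0 (Num.sqrt t).
have cs : Num.sqrt u @[u --> t] --> Num.sqrt t by exact: sqrt_continuous.
have cL k : L k (Num.sqrt u) @[u --> t] --> L k (Num.sqrt t).
  by apply: continuous_cvg cs; exact: continuousL.
have ne (x : R) : 0 < x -> x != 0 by move=> x0; rewrite gt_eqF.
apply: cvgN; apply: cvgM; last first.
  by apply: cvgV; [rewrite ne ?mulr_gt0|apply: cvgM => //; exact: cvg_cst].
apply: cvgB; first apply: cvgB; apply: cvgM => //.
- by apply: cvgV; [rewrite ne ?mulr_gt0|exact: cvgM].
- by apply: cvgV; [rewrite ne ?mulr_gt0|apply: cvgM => //; exact: cvgM].
- exact: cvgM.
- by apply: cvgV; [rewrite ne ?mulr_gt0|apply: cvgM => //; exact: cvgM].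
Qed.

(** Replaces [drv_profile] at the origin, where [f] may fail to be differentiable since it is
    arbitrary at negative arguments. It gives the partial derivatives of the mixture terms at their
    own targets. *)
Lemma drv_profile_sq0 : L 1 0 = 0 -> is_derive (0 : R) 1 (fun s => f (s ^+ 2)) 0.
Proof.
move=> L10; under eq_fun do rewrite fE.
have dsq := drvN (drvM (drvM (drv_id (0 : R)) (drv_id (0 : R))) (drv_cst (0 : R) 2^-1)).
have := drvM (drv_comp (is_derive_expR _) dsq) (dL 0 0).
by move/drv_eq; apply => /=; rewrite L10; ring.
Qed.

End shrinkage_profile.

(** * The differential inequality *)

Section weighted_sums.
Context {R : realType} (k : nat).
Implicit Types (p x y : 'I_k -> R).

(** Jensen's inequality for the square, by expanding a nonnegative variance. *)
Lemma sqr_sum_le p x : (forall i, 0 <= p i) -> \sum_i p i = 1 ->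
  (\sum_i p i * x i) ^+ 2 <= \sum_i p i * x i ^+ 2.
Proof.
move=> p0 p1; set m := \sum_i p i * x i.
have : 0 <= \sum_i p i * (x i - m) ^+ 2.
  by apply: sumr_ge0 => i _; rewrite mulr_ge0// sqr_ge0.
have -> : \sum_i p i * (x i - m) ^+ 2 =
    \sum_i (p i * x i ^+ 2 - 2 * m * (p i * x i) + m ^+ 2 * p i).
  by apply: eq_bigr => i _; ring.
rewrite big_split/= sumrB -!mulr_sumr p1 -/m; nra.
Qed.

(** Chebyshev's sum inequality for oppositely ordered families: the double sum of
    [p i * p j * ((x i - x j) * (y i - y j))] is twice the difference of the two sides. *)
Lemma chebyshev_sum p x y : (forall i, 0 <= p i) -> \sum_i p i = 1 ->
  (forall i j, (x i - x j) * (y i - y j) <= 0) ->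
  \sum_i p i * (x i * y i) <= (\sum_i p i * x i) * (\sum_i p i * y i).
Proof.
move=> p0 p1 xy.
have : \sum_i \sum_j p i * p j * ((x i - x j) * (y i - y j)) <= 0.
  apply: sumr_le0 => i _; apply: sumr_le0 => j _.
  by rewrite mulr_ge0_le0// mulr_ge0.
set A := \sum_i p i * (x i * y i); set X := \sum_i p i * x i.
set Y := \sum_i p i * y i.
have -> : \sum_i \sum_j p i * p j * ((x i - x j) * (y i - y j)) =
    \sum_i (p i * (x i * y i) - p i * x i * Y - p i * y i * X + p i * A).
  apply: eq_bigr => i _.
  rewrite -[X in X - _ - _]mulr1 -p1 !mulr_sumr -!sumrB -big_split/=.
  by apply: eq_bigr => j _; ring.
rewrite big_split/= !sumrB -!mulr_suml p1 -/A -/X -/Y; lra.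
Qed.

(** Polarization: inner products are traded for the distances [sqnorm (u i - u l)], which for
    offsets from the targets are distances between targets. *)
Lemma sqnorm_sum d (a : 'I_k -> R) (u : 'I_k -> 'rV[R]_d) :
  \sum_j (\sum_i a i * u i ord0 j) ^+ 2 =
  \sum_i \sum_l a i * a l *
    ((sqnorm (u i) + sqnorm (u l) - sqnorm (u i - u l)) / 2).
Proof.
have inner i l : (sqnorm (u i) + sqnorm (u l) - sqnorm (u i - u l)) / 2 =
    \sum_j u i ord0 j * u l ord0 j.
  rewrite /sqnorm -big_split/= -sumrB mulr_suml; apply: eq_bigr => j _.
  by rewrite !mxE; field.
under [RHS]eq_bigr => i _ do under eq_bigr => l _ do rewrite inner mulr_sumr.
rewrite [RHS](eq_bigr (fun i => \sum_j \sum_l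
  a i * a l * (u i ord0 j * u l ord0 j))) => [|i _]; last exact: exchange_big.
rewrite [RHS]exchange_big/=; apply: eq_bigr => j _.
rewrite expr2 big_distrlr/=; apply: eq_bigr => i _; apply: eq_bigr => l _.
ring.
Qed.

End weighted_sums.

Section differential_inequality.
Context {R : realType} (d k : nat).
Variables (p v : 'I_k -> R) (u : 'I_k -> 'rV[R]_d) (b c D rho : R).
Hypothesis p0 : forall i, 0 <= p i.
Hypothesis p1 : \sum_i p i = 1.
Hypothesis v0 : forall i, 0 <= v i.
Let t i := sqnorm (u i).
Let r i := t i * v i.

Lemma far_drift_bound : (forall i, r i <= b) ->
  b * (1 + rho ^+ 2 / 2) <= 2 * c ->
  (forall i l, (v i - v l) * (r i - r l) <= 0) ->
  (forall i l, sqnorm (u i - u l) <= D) ->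
  (forall i, D <= rho ^+ 2 * t i) ->
  2 * \sum_i p i * (v i * (r i - c)) <=
    \sum_j (\sum_i p i * v i * u i ord0 j) ^+ 2.
Proof.
move=> rb bc vr uD Dt.
set A := \sum_i p i * v i; set S := \sum_i p i * r i.
have A0 : 0 <= A by apply: sumr_ge0 => i _; rewrite mulr_ge0.
have Sb : S <= b.
  rewrite -[b]mul1r -p1 mulr_suml; apply: ler_sum => i _.
  by rewrite ler_wpM2l.
have cheb : \sum_i p i * (v i * r i) <= A * S by exact: chebyshev_sum.
have lhsE : \sum_i p i * (v i * (r i - c)) = \sum_i p i * (v i * r i) - c * A.
  rewrite /A mulr_sumr -sumrB; apply: eq_bigr => i _; ring.
(* The distance condition [D <= rho ^+ 2 * t i] averaged with the weights [p i * v i], where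
   [t i * v i = r i]. *)
have AD : A * D <= rho ^+ 2 * S.
  rewrite /A /S mulr_suml mulr_sumr; apply: ler_sum => i _.
  have := ler_wpM2l (mulr_ge0 (p0 i) (v0 i)) (Dt i); rewrite /r; lra.
have rhs_ge : A * S - A ^+ 2 * D / 2 <=
    \sum_j (\sum_i p i * v i * u i ord0 j) ^+ 2.
  rewrite sqnorm_sum.
  apply: (@le_trans _ _ (\sum_i \sum_l p i * v i * (p l * v l) *
      ((t i + t l - D) / 2))); last first.
    apply: ler_sum => i _; apply: ler_sum => l _.
    rewrite ler_wpM2l ?mulr_ge0// ler_wpM2r ?invr_ge0// lerB//.
  rewrite le_eqVlt; apply/orP; left; apply/eqP.
  have SE : S = \sum_i p i * v i * t i.
    by apply: eq_bigr => i _; rewrite /r; ring.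
  transitivity (\sum_i (A / 2 * (p i * v i * t i) +
      (S / 2 - A * D / 2) * (p i * v i))).
    by rewrite big_split/= -!mulr_sumr -SE -/A; field.
  apply: eq_bigr => i _.
  transitivity (\sum_l ((p i * v i * t i - p i * v i * D) / 2 * (p l * v l) +
      p i * v i / 2 * (p l * v l * t l))).
    by rewrite big_split/= -!mulr_sumr -SE -/A; field.
  by apply: eq_bigr => l _; field.
have Sc : S + rho ^+ 2 * S / 2 <= 2 * c.
  have rho2 : 0 <= 1 + rho ^+ 2 / 2 by have := sqr_ge0 rho; lra.
  have := ler_wpM2r rho2 Sb; lra.
(* This is the upper bound [2 * A * (S - c)] of the left-hand side minus the lower bound
   [A * S - A ^+ 2 * D / 2] of the right-hand side; [AD] and [Sc] make the bracket nonpositive. *)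
have : A * (S + A * D / 2 - 2 * c) <= 0 by rewrite mulr_ge0_le0//; lra.
rewrite lhsE; lra.
Qed.

(** The left-hand side of the conclusion is the right-hand integrand of Stein's identity, summed
    over coordinates. The sum over [j] turns [u i ord0 j ^+ 2] into [t i], and
    [0 <= v i + t i * v' i], which is r' >= 0, replaces [- 2 * t i * v' i] by [2 * v i]; this is how
    [d - 2] arises from [d]. *)
Lemma curvature_bound (v' : 'I_k -> R) :
  let g j := - \sum_i p i * v i * u i ord0 j in
  (forall i, 0 <= v i + t i * v' i) ->
  2 * \sum_i p i * (v i * (r i - (d%:R - 2))) <=
    \sum_j (\sum_i p i * v i * u i ord0 j) ^+ 2 ->
  \sum_j (2 * (\sum_i p i * (v i ^+ 2 * u i ord0 j ^+ 2
      - 2 * u i ord0 j ^+ 2 * v' i - v i) - g j ^+ 2 + 1) + g j ^+ 2)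
    <= 2 * d%:R.
Proof.
move=> g vv' drift.
pose h i j := p i * (v i ^+ 2 * u i ord0 j ^+ 2
  - 2 * u i ord0 j ^+ 2 * v' i - v i).
have hE i : \sum_j h i j = p i * ((v i ^+ 2 - 2 * v' i) * t i - d%:R * v i).
  rewrite -mulr_sumr; congr (_ * _).
  transitivity (\sum_j ((v i ^+ 2 - 2 * v' i) * u i ord0 j ^+ 2 - v i)).
    by apply: eq_bigr => j _; ring.
  by rewrite sumrB -mulr_sumr sumr_const card_ord -(mulr_natl (v i) d).
have gE : \sum_j g j ^+ 2 = \sum_j (\sum_i p i * v i * u i ord0 j) ^+ 2.
  by apply: eq_bigr => j _; rewrite /g sqrrN.
have -> : \sum_j (2 * (\sum_i h i j - g j ^+ 2 + 1) + g j ^+ 2) =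
    2 * (\sum_j \sum_i h i j) - \sum_j g j ^+ 2 + 2 * d%:R.
  rewrite mulr_sumr -sumrB; have -> : 2 * d%:R = \sum_(j < d) (2 : R).
    by rewrite sumr_const card_ord mulr_natr.
  by rewrite -big_split/=; apply: eq_bigr => j _; ring.
have -> : \sum_j \sum_i h i j =
    \sum_i p i * ((v i ^+ 2 - 2 * v' i) * t i - d%:R * v i).
  by rewrite exchange_big/=; apply: eq_bigr => i _; rewrite hE.
have : \sum_i p i * ((v i ^+ 2 - 2 * v' i) * t i - d%:R * v i) <=
    \sum_i p i * (v i * (r i - (d%:R - 2))).
  apply: ler_sum => i _; rewrite ler_wpM2l// /r.
  have := vv' i; lra.
rewrite gE; lra.
Qed.

End differential_inequality.

(** * Distance to one target versus distance to all *)

Section far_targets.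
Context {R : realType} (d : nat).
Implicit Types u x : 'rV[R]_d.

(* Young's inequality with the weight rho is sharp for the triangle
   inequality at |u| = sqrt D / rho and |x| = sqrt D. *)
Lemma sqnormD_young u x (rho : R) : 0 < rho ->
  sqnorm (u + x) <= (1 + rho) * sqnorm u + (1 + rho^-1) * sqnorm x.
Proof.
move=> rho0; rewrite /sqnorm !mulr_sumr -big_split/=; apply: ler_sum => j _.
rewrite mxE -subr_ge0.
have -> : (1 + rho) * u ord0 j ^+ 2 + (1 + rho^-1) * x ord0 j ^+ 2 -
    (u ord0 j + x ord0 j) ^+ 2 = rho^-1 * (rho * u ord0 j - x ord0 j) ^+ 2.
  by field; rewrite gt_eqF.
by rewrite mulr_ge0 ?invr_ge0 ?(ltW rho0)// sqr_ge0.
Qed.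

(** For [u] and [x] the offsets of one point from two targets. If |x|^2 < D / rho^2, Young's bound
    for u = x + (u - x) gives |u|^2 < (sqrt D / rho + sqrt D)^2 <= s0, a contradiction. *)
Lemma far_from_one_far_from_all u x (D rho s0 : R) : 0 <= D -> 0 < rho ->
  Num.sqrt (D / rho ^+ 2) + Num.sqrt D <= Num.sqrt s0 -> 0 <= s0 ->
  sqnorm (u - x) <= D -> s0 < sqnorm u -> D <= rho ^+ 2 * sqnorm x.
Proof.
move=> D0 rho0 Ds0 s00 uxD us0; rewrite leNgt; apply/negP => xD.
have sD : Num.sqrt (D / rho ^+ 2) = Num.sqrt D / rho.
  rewrite -[rho in RHS]ger0_norm ?(ltW rho0)// -sqrtr_sqr -sqrtrV ?sqr_ge0//.
  by rewrite -sqrtrM.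
have : s0 < (Num.sqrt D / rho + Num.sqrt D) ^+ 2.
  apply: (lt_trans us0).
  have := sqnormD_young x (u - x) rho0; rewrite addrC subrK => H.
  apply: (le_lt_trans H).
  have -> : (Num.sqrt D / rho + Num.sqrt D) ^+ 2 =
     (1 + rho) * (D / rho ^+ 2) + (1 + rho^-1) * D.
    by rewrite -{3 4}(sqr_sqrtr D0); field; rewrite gt_eqF.
  apply: ltr_leD.
    by rewrite ltr_pM2l ?addr_gt0// ltr_pdivlMr ?exprn_gt0// mulrC.
  by rewrite ler_wpM2l// addr_ge0// invr_ge0 ltW.
have : (Num.sqrt D / rho + Num.sqrt D) ^+ 2 <= s0.
  rewrite -[leRHS](sqr_sqrtr s00) -sD lerXn2r ?nnegrE ?addr_ge0 ?sqrtr_ge0//.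
by move=> /le_lt_trans H /H; rewrite ltxx.
Qed.

End far_targets.

(** * Risk of the multiple shrinkage estimator *)

Lemma cvg_rsum {R : realType} k (h : 'I_k -> R -> R) (l : 'I_k -> R) (s : R) :
  (forall i, h i z @[z --> s] --> l i) ->
  \sum_i h i z @[z --> s] --> \sum_i l i.
Proof.
move=> hl; apply: (@cvg_big _ _ _ _ _ _ _ _ _ h l) => //.
exact: add_continuous.
Qed.

(** * The score and its derivative along a line *)

Section posterior_score.
Context {R : realType} (k : nat).
Variables (f v v' : R -> R) (w : 'I_k -> R).
Hypothesis f_gt0 : forall t, 0 <= t -> 0 < f t.
Hypothesis df : forall t : R, 0 < t -> is_derive t 1 f (- (v t * f t / 2)).
Hypothesis dv : forall t : R, 0 < t -> is_derive t 1 v (v' t).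
Hypothesis cv' : forall t : R, 0 < t -> {for t, continuous v'}.
Hypothesis w0 : forall i, 0 < w i.
Hypothesis w1 : \sum_i w i = 1.
Implicit Types t e : 'I_k -> R.

(** The posterior weight of the [i]-th target, as a function of the squared distances. *)
Definition post_weight t i : R := w i * f (t i) / \sum_l w l * f (t l).

(* A coordinate of grad (log m_star), in terms of the squared distances t i
   to the targets and of the offsets e i along that coordinate. *)
Definition score t e : R := - \sum_i post_weight t i * v (t i) * e i.

(** The second logarithmic derivative m'' / m - (m' / m)^2 of the mixture along a coordinate; the
    sum is m'' / m. *)
Definition score' t e : R :=
  \sum_i post_weight t i * (v (t i) ^+ 2 * e i ^+ 2 - 2 * e i ^+ 2 * v' (t i) - v (t i))
  - score t e ^+ 2.

Lemma mixture_weight_gt0 t : (forall i, 0 <= t i) -> 0 < \sum_l w l * f (t l).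
Proof.
move=> t0; have k0 : (0 < k)%N.
  by move: w1; case: (k) w => [|//] w'; rewrite big_ord0 => /esym/eqP; rewrite oner_eq0.
rewrite lt_neqAle sumr_ge0 ?andbT => [|i _]; last by rewrite mulr_ge0 ?ltW ?f_gt0.
rewrite eq_sym; apply/eqP => /psumr_eq0P H.
have /eqP := H (fun i _ => ltW (mulr_gt0 (w0 i) (f_gt0 (t0 i)))) (Ordinal k0) isT.
by rewrite gt_eqF// mulr_gt0 ?f_gt0.
Qed.

Lemma post_weight_ge0 t i : (forall i, 0 <= t i) -> 0 <= post_weight t i.
Proof.
move=> t0; rewrite divr_ge0 ?(ltW (mixture_weight_gt0 t0))//.
by rewrite mulr_ge0 ?ltW ?f_gt0.
Qed.

Lemma sum_post_weight t : (forall i, 0 <= t i) -> \sum_i post_weight t i = 1.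
Proof.
by move=> t0; rewrite -mulr_suml divff// gt_eqF// mixture_weight_gt0.
Qed.

(** By Jensen's inequality it is enough that v^2 e^2 <= v^2 t <= t v <= b, where e^2 <= t and v <= 1
    are used. This is the boundedness that Stein's identity asks for. *)
Lemma score_sqr_le t e (b : R) : (forall i, 0 <= t i) ->
  (forall i, e i ^+ 2 <= t i) -> (forall i, 0 <= v (t i) <= 1) ->
  (forall i, t i * v (t i) <= b) -> score t e ^+ 2 <= b.
Proof.
move=> t0 et v01 tvb.
have p0 i := post_weight_ge0 i t0; have p1 := sum_post_weight t0.
rewrite /score sqrrN; under eq_bigr do rewrite -mulrA.
apply: (le_trans (sqr_sum_le (fun i => v (t i) * e i) p0 p1)).
rewrite -[b]mul1r -p1 mulr_suml; apply: ler_sum => i _; rewrite ler_wpM2l//.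
apply: le_trans (tvb i); rewrite exprMn.
have /andP[v0 v1] := v01 i.
apply: (@le_trans _ _ (v (t i) ^+ 2 * t i)).
  by rewrite ler_wpM2l// sqr_ge0.
by rewrite mulrC ler_wpM2l// expr2 ler_piMr.
Qed.

(** Jensen's inequality absorbs the squared score into the terms v^2 e^2; what remains is at least -
    v, hence at least -1, on average. *)
Lemma score'_ge t e : (forall i, 0 <= t i) ->
  (forall i, 0 <= v (t i) <= 1) -> (forall i, v' (t i) <= 0) ->
  - 1 <= score' t e.
Proof.
move=> t0 v01 v'0.
have p0 i := post_weight_ge0 i t0; have p1 := sum_post_weight t0.
have jensen : score t e ^+ 2 <= \sum_i post_weight t i * (v (t i) * e i) ^+ 2.
  rewrite /score sqrrN; under eq_bigr do rewrite -mulrA.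
  exact: (sqr_sum_le (fun i => v (t i) * e i) p0 p1).
rewrite /score'; set S := \sum_i _.
have : \sum_i (post_weight t i * (v (t i) * e i) ^+ 2 - post_weight t i) <= S.
  apply: ler_sum => i _; rewrite -[X in _ - X]mulr1 -mulrBr ler_wpM2l//.
  have /andP[vi0 vi1] := v01 i; rewrite exprMn.
  have : e i ^+ 2 * v' (t i) <= 0 by rewrite mulr_ge0_le0 ?sqr_ge0.
  lra.
rewrite sumrB p1; lra.
Qed.

Section line.
Variables a c : 'I_k -> R.
Hypothesis c0 : forall i, 0 < c i.
(** Squared distances along a line parallel to an axis: [a i] locates the target along the axis and
    [c i] is its squared distance to the line. Thus [c0] says that the line misses every target and
    [t] stays where [f] and [v] are differentiable. *)
Let t s i := (s - a i) ^+ 2 + c i.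
Let e s i := s - a i.

Let t0 s i : 0 < t s i.
Proof. by rewrite ltr_wpDl ?sqr_ge0. Qed.

Let dt i (s : R) : is_derive s 1 (t ^~ i) (2 * e s i).
Proof.
rewrite /t /e; have d1 := drvB (drv_id s) (drv_cst s (a i)).
have := drvD (drvM d1 d1) (drv_cst s (c i)).
by move/drv_eq; apply; ring.
Qed.

Let df_t i (s : R) :
  is_derive s 1 (fun s => f (t s i)) (- (v (t s i) * f (t s i) * e s i)).
Proof.
have := drv_comp (g := t ^~ i) (df (t0 s i)) (dt i s).
by move/drv_eq; apply; field.
Qed.

Let dv_t i (s : R) :
  is_derive s 1 (fun s => v (t s i)) (v' (t s i) * (2 * e s i)).
Proof. exact: (drv_comp (g := t ^~ i) (dv (t0 s i)) (dt i s)). Qed.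

Let M s := \sum_l w l * f (t s l).

Let M_gt0 s : 0 < M s.
Proof. by apply: mixture_weight_gt0 => i; exact: ltW. Qed.

Let N s := \sum_i w i * f (t s i) * (v (t s i) * e s i).

Let scoreE s : score (t s) (e s) = - (N s / M s).
Proof.
rewrite /score /N mulr_suml; congr (- _); apply: eq_bigr => i _.
by rewrite /post_weight -/(M s); ring.
Qed.

(** The score is [- (N / M)] with [M' = - N], so the quotient rule gives
    [- N' / M - (N / M) ^+ 2]. *)
Lemma drv_score_line (s : R) :
  is_derive s 1 (fun s => score (t s) (e s)) (score' (t s) (e s)).
Proof.
apply: (drv_ext (fun s => esym (scoreE s))).
have dM : is_derive s 1 M (- N s).
  rewrite /N -sumrN; apply: drv_sum => i.
  by have := drvZ (w i) (df_t i s); move/drv_eq; apply; ring.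
have dN : is_derive s 1 N (\sum_i w i * f (t s i) *
    (- (v (t s i) ^+ 2 * e s i ^+ 2) + 2 * e s i ^+ 2 * v' (t s i) + v (t s i))).
  apply: drv_sum => i.
  have de := drvB (drv_id s) (drv_cst s (a i)).
  have := drvM (drvZ (w i) (df_t i s)) (drvM (dv_t i s) de).
  by move/drv_eq; apply; rewrite /e; ring.
have := drvN (drvM dN (drvV (lt0r_neq0 (M_gt0 s)) dM)).
move/drv_eq; apply; rewrite /score' scoreE.
have -> : \sum_i post_weight (t s) i * (v (t s i) ^+ 2 * e s i ^+ 2 -
    2 * e s i ^+ 2 * v' (t s i) - v (t s i)) =
  - ((\sum_i w i * f (t s i) *
    (- (v (t s i) ^+ 2 * e s i ^+ 2) + 2 * e s i ^+ 2 * v' (t s i) + v (t s i))) / M s).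
  rewrite mulr_suml -sumrN; apply: eq_bigr => i _.
  by rewrite /post_weight -/(M s); ring.
by field; rewrite gt_eqF.
Qed.

Lemma continuous_score'_line : continuous (fun s => score' (t s) (e s)).
Proof.
move=> s.
have ce i : e z i @[z --> s] --> e s i.
  by apply: cvgB; [exact: cvg_id|exact: cvg_cst].
have cM : M z @[z --> s] --> M s.
  apply: cvg_rsum => i; apply: cvgM; first exact: cvg_cst.
  exact: (drv_continuous (df_t i s)).
have cp i : post_weight (t z) i @[z --> s] --> post_weight (t s) i.
  apply: cvgM; last first.
    by apply: cvgV; [rewrite gt_eqF ?M_gt0|exact: cM].
  apply: cvgM; first exact: cvg_cst.
  exact: (drv_continuous (df_t i s)).
have cv i : v (t z i) @[z --> s] --> v (t s i).
  exact: (drv_continuous (dv_t i s)).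
have cv't i : v' (t z i) @[z --> s] --> v' (t s i).
  have ct : t z i @[z --> s] --> t s i by exact: (drv_continuous (dt i s)).
  exact: (@cvg_comp _ _ _ (t ^~ i) v' _ _ _ ct (cv' (t0 s i))).
have cs : score (t z) (e z) @[z --> s] --> score (t s) (e s).
  exact: (drv_continuous (drv_score_line s)).
apply: cvgB; last by under eq_fun do rewrite expr2; apply: cvgM.
apply: cvg_rsum => i; apply: cvgM; first exact: cp.
apply: cvgB => //; apply: cvgB.
  by apply: cvgM; under eq_fun do rewrite expr2; apply: cvgM.
apply: cvgM => //; apply: cvgM; first exact: cvg_cst.
by under eq_fun do rewrite expr2; apply: cvgM.
Qed.

Lemma stein_line (b m : R) :
  (forall z, 0 <= z -> 0 <= v z <= 1) -> (forall z, 0 <= z -> v' z <= 0) ->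
  (forall z, 0 <= z -> z * v z <= b) ->
  (\int[lebesgue_measure]_s
     (((s - m + score (t s) (e s)) ^+ 2 + (s - m) ^+ 2) * normal_pdf m 1 s)%:E =
   \int[lebesgue_measure]_s
     ((2 * (score' (t s) (e s) + 1) + score (t s) (e s) ^+ 2) *
      normal_pdf m 1 s)%:E)%E.
Proof.
move=> v01 v'0 tvb.
rewrite (@normal_stein _ m 1 (oner_neq0 R) _ _ (Num.sqrt b)
  drv_score_line continuous_score'_line).
- by apply: eq_integral => s _; rewrite expr1n mulr1.
- by move=> s; apply: score'_ge => i; [exact: ltW|apply: v01|apply: v'0]; exact: ltW.
move=> s; rewrite -sqrtr_sqr ler_wsqrtr//; apply: score_sqr_le => i.
- exact: ltW.
- by rewrite lerDl ltW.
- by apply: v01; exact: ltW.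
- by apply: tvb; exact: ltW.
Qed.

End line.
End posterior_score.

(** * The estimator in coordinates *)

Section multiple_shrinkage_coordinates.
Context {R : realType} (d k : nat).
Variables (f v : R -> R) (w : 'I_k -> R) (target : 'I_k -> 'rV[R]_d).
Hypothesis df : forall t : R, 0 < t -> is_derive t 1 f (- (v t * f t / 2)).
Hypothesis df0 : is_derive (0 : R) 1 (fun s => f (s ^+ 2)) 0.

Lemma sqnorm_eq0 (x : 'rV[R]_d) : (sqnorm x == 0) = (x == 0).
Proof.
apply/eqP/eqP => [x0|->]; last first.
  by rewrite /sqnorm big1// => i _; rewrite mxE expr0n.
apply/rowP => i; rewrite mxE; apply/eqP; rewrite -sqrf_eq0; apply/eqP.
by move/psumr_eq0P : x0 => -> // j _; exact: sqr_ge0.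
Qed.

Lemma drv_sqnorm_line (x : 'rV[R]_d) j :
  is_derive (0 : R) 1 (fun h => sqnorm (h *: delta_mx ord0 j + x)) (2 * x ord0 j).
Proof.
have := @drv_sum R d
  (fun i h => (h * (i == j)%:R + x ord0 i) * (h * (i == j)%:R + x ord0 i))
  0 (fun i => (i == j)%:R * 2 * x ord0 i) _.
have -> : \sum_i (i == j)%:R * 2 * x ord0 i = 2 * x ord0 j.
  rewrite (bigD1 j)//= eqxx mul1r big1 ?addr0// => i /negbTE ->.
  by rewrite !mul0r.
rewrite (_ : (fun z => \sum_i _) = fun h => sqnorm (h *: delta_mx ord0 j + x)).
  apply => i.
  have d1 := drvD (drvM (drv_id (0 : R)) (drv_cst 0 (i == j)%:R))
    (drv_cst 0 (x ord0 i)).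
  by have := drvM d1 d1; move/drv_eq; apply => /=; ring.
apply/funext => h; rewrite /sqnorm; apply: eq_bigr => i _.
by rewrite !mxE eqxx/= expr2.
Qed.

Lemma drv_profile_line (x : 'rV[R]_d) j :
  is_derive (0 : R) 1 (fun h => f (sqnorm (h *: delta_mx ord0 j + x)))
    (- (v (sqnorm x) * f (sqnorm x) * x ord0 j)).
Proof.
(* At the origin the function is [f (h ^+ 2)], covered by [df0]; elsewhere the chain rule
   applies. *)
have [->|x0] := eqVneq x 0.
  rewrite mxE mulr0 oppr0.
  rewrite (_ : (fun h => _) = fun s => f (s ^+ 2))//; apply/funext => h.
  rewrite addr0 /sqnorm (bigD1 j)//= big1 ?addr0 => [|i /negbTE ij].
    by rewrite !mxE !eqxx mulr1.
  by rewrite !mxE ij andbF mulr0 expr0n.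
have sq0 : 0 < sqnorm x by rewrite lt_neqAle sqnorm_ge0 eq_sym sqnorm_eq0 x0.
have dfx : is_derive (sqnorm (0 *: delta_mx ord0 j + x)) 1 f
    (- (v (sqnorm x) * f (sqnorm x) / 2)).
  by rewrite scale0r add0r; exact: df.
have := drv_comp dfx (drv_sqnorm_line x j).
by move/drv_eq; apply; field.
Qed.

Lemma multiple_shrinkageE x j :
  multiple_shrinkage f w target x ord0 j = x ord0 j +
    score f v w (fun i => sqnorm (x - target i)) (fun i => (x - target i) ord0 j).
Proof.
rewrite /multiple_shrinkage !mxE; congr (_ + _).
pose phi h := mixture f w target (h *: delta_mx ord0 j + x).
have dphi : is_derive (0 : R) 1 phi
    (\sum_i w i * - (v (sqnorm (x - target i)) * f (sqnorm (x - target i)) *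
      (x - target i) ord0 j)).
  rewrite /phi /mixture; apply: (@drv_sum _ _
    (fun i h => w i * f (sqnorm (h *: delta_mx ord0 j + x - target i)))) => i.
  have := drvZ (w i) (drv_profile_line (x - target i) j).
  by congr is_derive; apply/funext => h; rewrite addrA.
(* The partial derivative and the one-variable derivative of [phi] have the same difference
   quotients. *)
have -> : 'D_(delta_mx ord0 j) (mixture f w target) x = 'D_1 phi 0.
  rewrite /derive.
  suff -> : (fun h : R => h^-1 *: ((mixture f w target \o shift x)
        (h *: delta_mx ord0 j) - mixture f w target x)) =
      (fun h => h^-1 *: ((phi \o shift 0) (h *: 1) - phi 0)) by [].
  apply/funext => h /=; rewrite /phi scale0r add0r.
  by rewrite addr0 /GRing.scale/= mulr1.
rewrite (@derive_val _ _ _ _ _ _ _ dphi) /score mulr_sumr -sumrN.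
apply: eq_bigr => i _; rewrite /post_weight /mixture; ring.
Qed.

End multiple_shrinkage_coordinates.

(** * From Stein's identity to the risk bound *)

Section multiple_shrinkage_risk.
Context {R : realType} (n k : nat).
Local Notation d := n.+2.
Variables (f v v' : R -> R) (w : 'I_k -> R) (target : 'I_k -> 'rV[R]_d) (b : R).
Hypothesis f_gt0 : forall t, 0 <= t -> 0 < f t.
Hypothesis df : forall t : R, 0 < t -> is_derive t 1 f (- (v t * f t / 2)).
Hypothesis df0 : is_derive (0 : R) 1 (fun s => f (s ^+ 2)) 0.
Hypothesis dv : forall t : R, 0 < t -> is_derive t 1 v (v' t).
Hypothesis cv' : forall t : R, 0 < t -> {for t, continuous v'}.
Hypothesis mf : measurable_fun [set: 'rV[R]_d] (fun x => f (sqnorm x)).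
Hypothesis mv : measurable_fun [set: R] v.
Hypothesis mv' : measurable_fun [set: R] v'.
Hypothesis w0 : forall i, 0 < w i.
Hypothesis w1 : \sum_i w i = 1.
Hypothesis v01 : forall t, 0 <= t -> 0 <= v t <= 1.
Hypothesis v'0 : forall t, 0 <= t -> v' t <= 0.
Hypothesis tvb : forall t, 0 <= t -> t * v t <= b.

Let sqd (x : 'rV[R]_d) i := sqnorm (x - target i).
Let off j (x : 'rV[R]_d) i := (x - target i) ord0 j.
Let S j x := score f v w (sqd x) (off j x).
Let S' j x := score' f v v' w (sqd x) (off j x).

Let sqd_ge0 x i : 0 <= sqd x i. Proof. exact: sqnorm_ge0. Qed.

Let measurable_off j i : measurable_fun [set: 'rV[R]_d] (fun x => off j x i).
Proof.
rewrite /off; under eq_fun do rewrite !mxE.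
by apply: measurable_funB => //; exact: measurable_rV_coord.
Qed.

Let measurable_sub i : measurable_fun [set: 'rV[R]_d] (fun x => x - target i).
Proof. by apply/measurable_fun_rVP => j; exact: measurable_off. Qed.

Let measurable_sqd i : measurable_fun [set: 'rV[R]_d] (fun x => sqd x i).
Proof. exact: (measurableT_comp (@measurable_sqnorm R d)). Qed.

Let measurable_weight i :
  measurable_fun [set: 'rV[R]_d] (fun x => post_weight f w (sqd x) i).
Proof.
have mfi l : measurable_fun [set: 'rV[R]_d] (fun x => w l * f (sqd x l)).
  apply: measurable_funM => //.
  exact: (measurableT_comp mf).
apply: measurable_funM => //; apply: measurable_inv_ge0.
  by move=> x; apply: ltW; exact: mixture_weight_gt0.
exact: measurable_sum.
Qed.

Let measurable_S j : measurable_fun [set: 'rV[R]_d] (S j).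
Proof.
apply: measurable_funN; apply: measurable_sum => i.
apply: measurable_funM => //; apply: measurable_funM => //.
exact: (measurableT_comp mv).
Qed.

Let measurable_S' j : measurable_fun [set: 'rV[R]_d] (S' j).
Proof.
have mvi i : measurable_fun [set: 'rV[R]_d] (fun x => v (sqd x i)).
  exact: (measurableT_comp mv).
apply: measurable_funB; last by apply: measurable_funX; exact: measurable_S.
apply: measurable_sum => i; apply: measurable_funM => //.
apply: measurable_funB => //; apply: measurable_funB.
  by apply: measurable_funM; apply: measurable_funX;
    [exact: mvi|exact: measurable_off].
apply: measurable_funM; last exact: (measurableT_comp mv').
by apply: measurable_funM => //; apply: measurable_funX; exact: measurable_off.
Qed.

Let S'_ge j x : - 1 <= S' j x.
Proof.
by apply: (score'_ge f_gt0 w0 w1) => i;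
  [exact: sqd_ge0|apply: v01|apply: v'0]; exact: sqd_ge0.
Qed.

Let del j (x : 'rV[R]_d) : 'rV[R]_n.+1 := \row_l x ord0 (lift j l).

Let off_insert j s y i :
  off j (rV_insert j s y) i = s - target i ord0 j.
Proof. by rewrite /off !mxE unlift_none. Qed.

Let sqd_insert j s y i : sqd (rV_insert j s y) i =
  (s - target i ord0 j) ^+ 2 + sqnorm (y - del j (target i)).
Proof.
rewrite /sqd /sqnorm (bigD1_ord j)//=; congr (_ + _).
  by rewrite !mxE unlift_none.
by apply: eq_bigr => l _; rewrite !mxE liftK.
Qed.

Local Open Scope ereal_scope.

(** Both sides are sliced along [j], and [stein_line] is applied on almost every line. *)
Let stein_coord j (theta : 'rV[R]_d) :
  \int[lebesgue_rV R d]_x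
    (((x ord0 j - theta ord0 j + S j x) ^+ 2 + (x ord0 j - theta ord0 j) ^+ 2)
      * std_gauss_pdf (x - theta))%:E =
  \int[lebesgue_rV R d]_x
    ((2 * (S' j x + 1) + S j x ^+ 2) * std_gauss_pdf (x - theta))%:E.
Proof.
have mgauss := measurable_std_gauss_pdf theta.
have gauss0 (x : 'rV[R]_d) := std_gauss_pdf_ge0 x.
have mx : measurable_fun [set: 'rV[R]_d] (fun x => (x ord0 j - theta ord0 j)%R).
  by apply: measurable_funB => //; exact: measurable_rV_coord.
set F := fun x : 'rV[R]_d => (((x ord0 j - theta ord0 j + S j x) ^+ 2 +
  (x ord0 j - theta ord0 j) ^+ 2) * std_gauss_pdf (x - theta))%:E.
set G := fun x : 'rV[R]_d =>
  ((2 * (S' j x + 1) + S j x ^+ 2) * std_gauss_pdf (x - theta))%:E.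
have mF : measurable_fun [set: 'rV[R]_d] F.
  apply/measurable_EFinP; apply: measurable_funM => //; apply: measurable_funD.
    by apply: measurable_funX; exact: measurable_funD.
  exact: measurable_funX.
have mG : measurable_fun [set: 'rV[R]_d] G.
  apply/measurable_EFinP; apply: measurable_funM => //; apply: measurable_funD.
    by apply: measurable_funM => //; exact: measurable_funD.
  exact: measurable_funX.
have F0 x : 0 <= F x.
  by rewrite lee_fin; apply: mulr_ge0 => //; rewrite addr_ge0// sqr_ge0.
have G0 x : 0 <= G x.
  rewrite lee_fin; apply: mulr_ge0 => //; rewrite addr_ge0 ?sqr_ge0//.
  by have := S'_ge j x; lra.
rewrite (integral_rV_slice j mF F0) (integral_rV_slice j mG G0).
have mslice (H : 'rV[R]_d -> \bar R) : measurable_fun [set: 'rV[R]_d] H ->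
    (forall x, 0 <= H x) -> measurable_fun [set: 'rV[R]_n.+1]
      (fun y => \int[lebesgue_measure]_s H (rV_insert j s y)).
  move=> mH H0; apply: (measurable_fun_fubini_tonelli_G
    (fun p : measurableTypeR R * 'rV[R]_n.+1 => H (rV_insert j p.1 p.2))) => //.
  by apply: measurableT_comp => //; exact: measurable_rV_insert.
apply: ge0_ae_eq_integral => //.
- exact: mslice.
- exact: mslice.
- by move=> y _; exact: integral_ge0.
- by move=> y _; exact: integral_ge0.
(* Only finitely many lines parallel to the axis hit a target. They form a null set because the
   transversal dimension [n.+1] is positive. *)
have good : {ae lebesgue_rV R n.+1, forall y, forall i, y <> del j (target i)}.
  apply: filter_forall => i; exists [set del j (target i)]; split.
  - exact: measurable_rV_set1.
  - exact: lebesgue_rV_set1.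
  - by move=> y /= /contrapT.
apply: filterS good => y ybad _.
have c0 i : (0 < sqnorm (y - del j (target i)))%R.
  rewrite lt_neqAle sqnorm_ge0 eq_sym sqnorm_eq0 subr_eq0 andbT; apply/eqP.
  exact: ybad.
(* The Gaussian factor of the other coordinates, constant along the line. *)
pose C := (\prod_l normal_pdf (theta ord0 (lift j l)) 1 (y ord0 l))%R.
have C0 : (0 <= C)%R by apply: prodr_ge0 => l _; exact: normal_pdf_ge0.
have gaussE s : std_gauss_pdf (rV_insert j s y - theta) =
    (normal_pdf (theta ord0 j) 1 s * C)%R.
  rewrite std_gauss_pdfE (bigD1_ord j)//= rV_insert_at; congr (_ * _)%R.
  by apply: eq_bigr => l _; rewrite rV_insert_lift.
have stein := stein_line f_gt0 df dv cv' w0 w1 (fun i => target i ord0 j) c0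
  (theta ord0 j) v01 v'0 tvb.
have minsert (H : 'rV[R]_d -> R) : measurable_fun [set: 'rV[R]_d] H ->
    measurable_fun [set: R] (fun s => H (rV_insert j s y)).
  move=> mH; apply: (measurableT_comp mH).
  apply: (measurableT_comp (measurable_rV_insert j)
    (g := fun s : measurableTypeR R => (s, y))).
  exact: measurable_pair2.
have scaleC (H : 'rV[R]_d -> R) : measurable_fun [set: 'rV[R]_d] H ->
    (forall x, 0 <= H x)%R ->
    \int[lebesgue_measure]_s
      (H (rV_insert j s y) * std_gauss_pdf (rV_insert j s y - theta))%:E =
    C%:E * \int[lebesgue_measure]_s
      (H (rV_insert j s y) * normal_pdf (theta ord0 j) 1 s)%:E.
  move=> mH H0; under eq_integral do rewrite gaussE mulrA mulrC EFinM.
  rewrite ge0_integralZl//.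
    apply/measurable_EFinP; apply: measurable_funM; first exact: minsert.
    exact: measurable_normal_pdf.
  by move=> s _; rewrite lee_fin mulr_ge0 ?normal_pdf_ge0.
have tE s : sqd (rV_insert j s y) =
    fun i => ((s - target i ord0 j) ^+ 2 + sqnorm (y - del j (target i)))%R.
  by apply/funext => i; exact: sqd_insert.
have eE s : off j (rV_insert j s y) = fun i => (s - target i ord0 j)%R.
  by apply/funext => i; exact: off_insert.
rewrite /F /G (scaleC (fun x : 'rV[R]_d => (x ord0 j - theta ord0 j + S j x) ^+ 2 +
  (x ord0 j - theta ord0 j) ^+ 2)%R); last 2 first.
- apply: measurable_funD; last exact: measurable_funX.
  by apply: measurable_funX; exact: measurable_funD.
- by move=> x; rewrite addr_ge0// sqr_ge0.
rewrite (scaleC (fun x => 2 * (S' j x + 1) + S j x ^+ 2)%R); last 2 first.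
- apply: measurable_funD; last by apply: measurable_funX; exact: measurable_S.
  by apply: measurable_funM => //; exact: measurable_funD.
- by move=> x; rewrite addr_ge0 ?sqr_ge0//; have := S'_ge j x; lra.
congr (_ * _).
transitivity (\int[lebesgue_measure]_s
   (((s - theta ord0 j + score f v w
       (fun i => (s - target i ord0 j) ^+ 2 + sqnorm (y - del j (target i)))
       (fun i => s - target i ord0 j)) ^+ 2 + (s - theta ord0 j) ^+ 2) *
      normal_pdf (theta ord0 j) 1 s)%:E).
  by apply: eq_integral => s _; rewrite /S tE eE rV_insert_at.
rewrite stein; apply: eq_integral => s _.
by rewrite /S /S' tE eE.
Qed.

Lemma measurable_multiple_shrinkage :
  measurable_fun [set: 'rV[R]_d] (multiple_shrinkage f w target).
Proof.
apply/measurable_fun_rVP => j.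
rewrite (_ : _ \o _ = (fun x : 'rV[R]_d => x ord0 j + S j x)%R).
  apply: measurable_funD; [exact: measurable_rV_coord|exact: measurable_S].
by apply/funext => x; exact: multiple_shrinkageE.
Qed.

Lemma multiple_shrinkage_risk_le theta :
  (forall x, \sum_j (2 * (S' j x + 1) + S j x ^+ 2) <= 2 * d%:R)%R ->
  risk theta (multiple_shrinkage f w target) <= d%:R%:E.
Proof.
move=> curv.
have mgauss := measurable_std_gauss_pdf theta.
have gauss0 (x : 'rV[R]_d) := std_gauss_pdf_ge0 x.
have mx j : measurable_fun [set: 'rV[R]_d] (fun x => (x ord0 j - theta ord0 j)%R).
  by apply: measurable_funB => //; exact: measurable_rV_coord.
pose E j (x : 'rV[R]_d) := ((x ord0 j - theta ord0 j + S j x) ^+ 2)%R.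
pose Q j (x : 'rV[R]_d) := ((x ord0 j - theta ord0 j) ^+ 2)%R.
pose G j x := (2 * (S' j x + 1) + S j x ^+ 2)%R.
have mE j : measurable_fun [set: 'rV[R]_d] (E j).
  by apply: measurable_funX; apply: measurable_funD => //; exact: measurable_S.
have mQ j : measurable_fun [set: 'rV[R]_d] (Q j) by apply: measurable_funX; exact: mx.
have mG j : measurable_fun [set: 'rV[R]_d] (G j).
  apply: measurable_funD; last by apply: measurable_funX; exact: measurable_S.
  by apply: measurable_funM => //; apply: measurable_funD => //; exact: measurable_S'.
have G0 j x : (0 <= G j x)%R.
  by rewrite addr_ge0 ?sqr_ge0//; have := S'_ge j x; lra.
have mgaussM (H : 'rV[R]_d -> R) : measurable_fun [set: 'rV[R]_d] H ->
    measurable_fun [set: 'rV[R]_d] (fun x => (H x * std_gauss_pdf (x - theta))%:E).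
  by move=> mH; apply/measurable_EFinP; exact: measurable_funM.
have gauss_ge0 (H : 'rV[R]_d -> R) x : (0 <= H x)%R ->
    0 <= (H x * std_gauss_pdf (x - theta))%:E.
  by move=> H0; rewrite lee_fin; apply: mulr_ge0.
have riskE : risk theta (multiple_shrinkage f w target) =
    \sum_j \int[lebesgue_rV R d]_x (E j x * std_gauss_pdf (x - theta))%:E.
  rewrite -ge0_integral_sum//; last 2 first.
  - by move=> j; exact: mgaussM.
  - by move=> j x _; apply: gauss_ge0; exact: sqr_ge0.
  apply: eq_integral => x _; rewrite sumEFin -mulr_suml; congr (_ * _)%:E.
  apply: eq_bigr => j _; rewrite mxE multiple_shrinkageE// mxE; congr (_ ^+ 2)%R.
  by rewrite addrAC.
have varE : \sum_j \int[lebesgue_rV R d]_x (Q j x * std_gauss_pdf (x - theta))%:E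
    = d%:R%:E.
  transitivity (\sum_(j < d) (1 : \bar R)); last first.
    by rewrite sumEFin sumr_const card_ord.
  apply: eq_bigr => j _.
  transitivity (\int[lebesgue_rV R d]_x ((theta ord0 j - x ord0 j) ^+ 2 *
      \prod_i normal_pdf (theta ord0 i) 1 (x ord0 i))%:E).
    by apply: eq_integral => x _; rewrite std_gauss_pdfE -[in RHS]sqrrN opprB.
  rewrite (@integral_prod_density_coord _ _ (fun i => normal_pdf (theta ord0 i) 1) j
    (fun s => ((theta ord0 j - s) ^+ 2)%R)).
  - by rewrite normal_sq_dev ?oner_neq0// subrr expr0n addr0 expr1n.
  - by move=> i; exact: measurable_normal_pdf.
  - by move=> i s; exact: normal_pdf_ge0.
  - by move=> i; apply: integral_normal_pdf; exact: oner_neq0.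
  - by apply: measurable_funX; exact: measurable_funB.
  - by move=> s; exact: sqr_ge0.
have gauss1 : \int[lebesgue_rV R d]_x (2 * d%:R * std_gauss_pdf (x - theta))%:E =
    (2 * d%:R)%:E.
  under eq_integral do rewrite std_gauss_pdfE EFinM.
  rewrite ge0_integralZl//.
  - rewrite (@integral_prod_density _ _
      (fun i => normal_pdf (theta ord0 i) 1)) ?mule1//.
    + by move=> i; exact: measurable_normal_pdf.
    + by move=> i s; exact: normal_pdf_ge0.
    + by move=> i; apply: integral_normal_pdf; exact: oner_neq0.
  - apply/measurable_EFinP.
    apply: (measurable_prod_coord (g := fun i => normal_pdf (theta ord0 i) 1)) => i.
    exact: measurable_normal_pdf.
  - by move=> x _; rewrite lee_fin prodr_ge0// => i _; exact: normal_pdf_ge0.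
(* The risk plus the total variance [d] of X is the left-hand side of Stein's identity summed over
   coordinates. The variance is cancelled only after this bound has excluded an infinite risk. *)
have : risk theta (multiple_shrinkage f w target) + d%:R%:E <= (2 * d%:R)%:E.
  rewrite riskE -varE -big_split/= -gauss1.
  rewrite (eq_bigr (fun j =>
      \int[lebesgue_rV R d]_x (G j x * std_gauss_pdf (x - theta))%:E)).
    rewrite -ge0_integral_sum//; last 2 first.
    - by move=> j; exact: mgaussM.
    - by move=> j x _; exact: gauss_ge0.
    apply: ge0_le_integral => //.
    - by move=> x _; apply: sume_ge0 => j _; exact: gauss_ge0.
    - by apply: emeasurable_sum => j; exact: mgaussM.
    - exact: mgaussM.
    - move=> x _; rewrite sumEFin -mulr_suml lee_fin.
      by apply: ler_wpM2r => //; exact: curv.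
  move=> j _; rewrite -stein_coord -ge0_integralD//.
  - by apply: eq_integral => x _; rewrite -EFinD -mulrDl.
  - by move=> x _; apply: gauss_ge0; exact: sqr_ge0.
  - exact: mgaussM.
  - by move=> x _; apply: gauss_ge0; exact: sqr_ge0.
  - exact: mgaussM.
case: (risk _ _) => [r| |]//.
- by rewrite -EFinD !lee_fin; lra.
- by move=> _; rewrite leNye.
Qed.

End multiple_shrinkage_risk.

(** * Monotonicity and the sign of the derivative *)

Section monotone_derivative.
Context {R : realType}.
Implicit Types f df : R -> R.

Lemma drv_nonincreasing_le0 f df :
  (forall x : R, 0 < x -> is_derive x 1 f (df x)) ->
  (forall x y : R, 0 < x -> x <= y -> f y <= f x) ->
  forall x : R, 0 < x -> df x <= 0.
Proof.
move=> dfx fdecr x x0; apply/ler_addgt0Pr => e e0; rewrite add0r.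
(* Subtracting [e * z] makes the monotonicity strict; [e] is then arbitrary. *)
pose g z := f z - e * z.
have dg (z : R) : 0 < z -> is_derive z 1 g (df z - e).
  move=> z0; have := drvB (dfx _ z0) (drvZ e (drv_id z)).
  by rewrite mulr1.
have dgE : derive1 g x = df x - e.
  by rewrite derive1E; exact: (@derive_val _ _ _ _ _ _ _ (dg _ x0)).
rewrite -subr_le0 -dgE; apply: (@decr_derive1_le0_itvy _ g false 0).
- by move=> z; rewrite inE/= in_itv/= andbT => z0; have [] := dg _ z0.
- move=> y z; rewrite !in_itv/= !andbT => y0 z0 zy; rewrite /g.
  have := fdecr _ _ z0 (ltW zy); have : e * z < e * y by rewrite ltr_pM2l.
  lra.
- by rewrite in_itv/= x0.
Qed.

Lemma drv_ge0_nondecreasing f df :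
  (forall x : R, 0 < x -> is_derive x 1 f (df x)) ->
  (forall x : R, 0 < x -> 0 <= df x) ->
  forall x y : R, 0 < x -> x <= y -> f x <= f y.
Proof.
move=> dfx df0 x y x0 xy.
have pos z : z \in `[x, y]%R -> 0 < z.
  by rewrite in_itv/= => /andP[+ _]; exact: lt_le_trans.
have posoo z : z \in `]x, y[%R -> 0 < z.
  by move=> zxy; apply: pos; exact: subset_itv_oo_cc.
apply: (@ger0_derive1_le_cc _ f x y); rewrite ?in_itv/= ?lexx ?xy//.
- by move=> z /posoo z0; have [] := dfx _ z0.
- move=> z /posoo z0; rewrite derive1E (@derive_val _ _ _ _ _ _ _ (dfx _ z0)).
  exact: df0.
- apply: derivable_within_continuous => z zxy.
  by have [] := dfx _ (pos _ zxy).
Qed.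

End monotone_derivative.

Lemma sqnorm_le_max_sqdist (R : realType) d k (target : 'I_k -> 'rV[R]_d) i l :
  sqnorm (target i - target l) <= max_sqdist target.
Proof.
have max0 : 0 <= max_sqdist target.
  rewrite /max_sqdist; elim/big_rec: _ => // p z _ z0.
  by rewrite le_max z0 orbT.
have [->|il] := eqVneq i l.
  by rewrite subrr /sqnorm big1// => j _; rewrite mxE expr0n.
rewrite /max_sqdist (bigD1 (i, l))//= le_max lexx//.
Qed.

(** * Minimaxity of the multiple shrinkage estimator *)

Theorem theorem2 (R : realType) (d k : nat)
    (prior : R -> R) (f : R -> R)
    (target : 'I_k -> 'rV[R]_d) (w : 'I_k -> R) (b rho s0 : R) :
  let r := shrinkage_ratio f in
  let D := max_sqdist target in
  let t0 := D / rho ^+ 2 in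
  measurable_fun (`[0, +oo[ : set R) prior ->
  (forall t, 0 <= t -> 0 <= prior t) ->
  (forall x : 'rV[R]_d, (0 < marginal prior x < +oo)%E) ->
  (forall x : 'rV[R]_d, marginal prior x = (f (sqnorm x))%:E) ->
  injective target ->
  (forall i, 0 < w i) ->
  \sum_i w i = 1 ->
  (forall t, 0 < t -> derivable r t 1 /\ 0 <= derive1 r t) ->
  (forall t, 0 <= t -> 0 <= r t <= b) ->
  b = sup [set r t | t in `[0, +oo[] ->
  d%:R - 2 < b < 2 * (d%:R - 2) ->
  (forall t u, 0 < t -> t <= u -> r u / u <= r t / t) ->
  0 < rho < 1 ->
  rho <= (2 * (d%:R - 2) - b) / (2 * b - 2 * (d%:R - 2)) ->
  0 <= s0 ->
  Num.sqrt t0 + Num.sqrt D <= Num.sqrt s0 ->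
  (forall t, 0 <= t <= s0 -> r t <= d%:R - 2) ->
  minimax (multiple_shrinkage f w target).
Proof.
(* The bounds on [b] force [d - 2 > 0], which excludes dimensions 0 and 1 and leaves the form [n.+2]
   that slicing uses. *)
case: d target => [|[|n]] target r D t0 mprior prior0 marg_gt0 margE _ w0 w1
  r'0 rb _ /andP[cb b2c] r_t /andP[rho0 rho1] rho_le s0_ge0 sqrt_s0 rs; [lra|lra|].
have [L [dL fE L1_ge0 L10]] := marginal_laplace mprior prior0 margE.
have f_gt0 t : 0 <= t -> 0 < f t.
  (* Every [t >= 0] is the squared norm of a point on the first axis. *)
  move=> t_ge0; have /andP[] := marg_gt0 (Num.sqrt t *: delta_mx ord0 ord0).
  rewrite margE lte_fin (_ : sqnorm _ = t)// /sqnorm (bigD1 ord0)//= big1 ?addr0.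
    by rewrite !mxE !eqxx mulr1 sqr_sqrtr.
  by move=> i /negbTE i0; rewrite !mxE i0 mulr0 expr0n.
pose v := shrink_factor L; pose v' := shrink_factor' L.
have df (t : R) (t_gt0 : 0 < t) := drv_profile dL fE f_gt0 t_gt0.
have dv (t : R) (t_gt0 : 0 < t) := drv_shrink_factor dL fE f_gt0 t_gt0.
have rE t : 0 < t -> r t = t * v t by exact: shrinkage_ratioE.
have v00 : v 0 = 1 by rewrite /v /shrink_factor sqrtr0 mul0r invr0 mulr0 subr0.
have v'00 : v' 0 = 0.
  by rewrite /v' /shrink_factor' sqrtr0 !(mulr0, invr0) oppr0.
have v_le1 t : 0 <= t -> v t <= 1.
  rewrite le_eqVlt => /predU1P[<-|t_gt0]; first by rewrite v00.
  exact: (shrink_factor_le1 fE f_gt0 L1_ge0).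
have v_ge0 t : 0 <= t -> 0 <= v t.
  rewrite le_eqVlt => /predU1P[<-|t_gt0]; first by rewrite v00.
  by have /andP[+ _] := rb _ (ltW t_gt0); rewrite rE// pmulr_rge0.
have v_anti t u : 0 <= t -> t <= u -> v u <= v t.
  rewrite le_eqVlt => /predU1P[<-|t_gt0] tu; first by rewrite v00 v_le1.
  have u_gt0 := lt_le_trans t_gt0 tu.
  have := r_t _ _ t_gt0 tu; rewrite !rE// -!mulrA ![v _ / _]mulrC !mulrA.
  by rewrite !divff ?gt_eqF// !mul1r.
have v'_le0 t : 0 <= t -> v' t <= 0.
  rewrite le_eqVlt => /predU1P[<-|]; first by rewrite v'00.
  apply: (@drv_nonincreasing_le0 _ v v') => // x y x0; exact/v_anti/ltW.
have dtv (t : R) : 0 < t -> is_derive t 1 (fun t => t * v t) (v t + t * v' t).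
  by move=> t_gt0; have := drvM (drv_id t) (dv _ t_gt0); rewrite mul1r.
have r'_ge0 t : 0 <= t -> 0 <= v t + t * v' t.
  rewrite le_eqVlt => /predU1P[<-|t_gt0]; first by rewrite v00 mul0r addr0.
  have [_] := r'0 _ t_gt0; rewrite derive1E.
  have rtv : \near t, r t = t * v t.
    near=> u; apply: rE.
    by near: u; exact: lt_nbhsr.
  by rewrite (near_eq_derive _ rtv) (@derive_val _ _ _ _ _ _ _ (dtv _ t_gt0)).
have r_homo t u : 0 <= t -> t <= u -> t * v t <= u * v u.
  rewrite le_eqVlt => /predU1P[<-|t_gt0] tu.
    by rewrite mul0r mulr_ge0// v_ge0.
  apply: (drv_ge0_nondecreasing dtv) => // x x0.
  by apply: r'_ge0; exact: ltW.
have tvb t : 0 <= t -> t * v t <= b.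
  rewrite le_eqVlt => /predU1P[<-|t_gt0]; first by rewrite mul0r; lra.
  by have /andP[_] := rb _ (ltW t_gt0); rewrite rE.
have v01 t : 0 <= t -> 0 <= v t <= 1 by move=> t_ge0; rewrite v_ge0 ?v_le1.
have near_le t : 0 <= t -> t <= s0 -> t * v t <= n.+2%:R - 2.
  rewrite le_eqVlt => /predU1P[<-|t_gt0] ts0.
    by rewrite mul0r; lra.
  by have := rs t; rewrite rE// ts0 ltW//; exact.
have opposite t u : 0 <= t -> 0 <= u -> (v t - v u) * (t * v t - u * v u) <= 0.
  move=> t_ge0 u_ge0; have [tu|/ltW ut] := leP t u.
    by rewrite mulr_ge0_le0// ?subr_ge0 ?subr_le0 ?v_anti ?r_homo.
  by rewrite mulr_le0_ge0// ?subr_ge0 ?subr_le0 ?v_anti ?r_homo.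
have D0 : 0 <= D.
  by rewrite /D /max_sqdist; elim/big_rec: _ => // p z _ z0; rewrite le_max z0 orbT.
(* Cleared of denominators, the hypothesis on [rho] is [b_rho2]. Multiplying the claim by [1 + rho]
   reduces it to [poly_rho], that is, to rho + rho^2 <= 2. *)
have b_rho : b * (1 + rho ^+ 2 / 2) <= 2 * (n.+2%:R - 2).
  have b_rho2 : b * (1 + 2 * rho) <= 2 * (n.+2%:R - 2) * (1 + rho).
    by move: rho_le; rewrite ler_pdivlMr; lra.
  have poly_rho : (1 + rho) * (1 + rho ^+ 2 / 2) <= 1 + 2 * rho by nra.
  rewrite -(ler_pM2l (_ : 0 < 1 + rho)); last lra.
  have b_ge0 : 0 <= b by lra.
  have := ler_wpM2l b_ge0 poly_rho; lra.
have mf : measurable_fun [set: 'rV[R]_n.+2] (fun x => f (sqnorm x)).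
  rewrite (_ : (fun x => _) = fun x : 'rV[R]_n.+2 =>
      expR (- (sqnorm x / 2)) * L 0 (Num.sqrt (sqnorm x))).
    apply: measurable_funM.
      apply: measurableT_comp => //; apply: measurable_funN.
      by apply: measurable_funM => //; exact: measurable_sqnorm.
    have mL0 : measurable_fun [set: R] (fun t => L 0 (Num.sqrt t)).
      apply: continuous_measurable_fun => t.
      apply: (@continuous_comp _ _ _ Num.sqrt (L 0)); first exact: sqrt_continuous.
      exact: (drv_continuous (dL 0 _)).
    exact: (measurableT_comp mL0 (@measurable_sqnorm R n.+2)).
  by apply/funext => x; rewrite (profileE fE)// sqnorm_ge0.
have mds := measurable_multiple_shrinkage target f_gt0 df (drv_profile_sq0 dL fE L10) mf
  (measurable_shrink_factor dL fE f_gt0) w0 w1.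
have risk_le theta : (risk theta (multiple_shrinkage f w target) <= n.+2%:R%:E)%E.
  apply: (@multiple_shrinkage_risk_le _ _ _ f v v' w target b) => //.
  - exact: drv_profile_sq0 dL fE L10.
  - by move=> t t_gt0; exact: (continuous_shrink_factor' dL fE f_gt0).
  - exact: (measurable_shrink_factor dL fE f_gt0).
  - exact: (measurable_shrink_factor' dL fE f_gt0).
  move=> x; set t := fun i => sqnorm (x - target i).
  have t_ge0 i : 0 <= t i by exact: sqnorm_ge0.
  have p0 i : 0 <= post_weight f w t i by exact: post_weight_ge0.
  have p1 : \sum_i post_weight f w t i = 1 by exact: sum_post_weight.
  have := @curvature_bound _ _ _ (post_weight f w t) (fun i => v (t i))
    (fun i => x - target i) p0 (fun i => v' (t i))
    (fun i => r'_ge0 _ (t_ge0 i)).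
  apply.
  (* One target beyond [s0] puts all targets beyond D / rho^2; otherwise r <= d - 2 at every target
     and each term of the sum is nonpositive. *)
  have [far|near] := pselect (exists i, s0 < t i).
    have [i0 ti0] := far.
    apply: (far_drift_bound (D := D) p0 p1 (fun i => v_ge0 _ (t_ge0 i))
      (fun i => tvb _ (t_ge0 i)) b_rho
      (fun i l => opposite _ _ (t_ge0 i) (t_ge0 l))) => [i l|i].
    - rewrite (_ : _ - _ = target l - target i); first exact: sqnorm_le_max_sqdist.
      by rewrite opprB addrC addrA subrK.
    - apply: (far_from_one_far_from_all (u := x - target i0) (s0 := s0)) => //.
      rewrite (_ : _ - _ = target i - target i0); first exact: sqnorm_le_max_sqdist.
      by rewrite opprB addrC addrA subrK.
  apply: (@le_trans _ _ 0); last by apply: sumr_ge0 => j _; exact: sqr_ge0.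
  rewrite pmulr_rle0//; apply: sumr_le0 => i _.
  apply: mulr_ge0_le0 => //; apply: mulr_ge0_le0; first exact: v_ge0.
  rewrite subr_le0; apply: near_le; first exact: t_ge0.
  by rewrite leNgt; apply/negP => tis0; apply: near; exists i.
split; first exact: mds.
(* Both values equal [d]: the risk is at most [d] everywhere, and [max_risk_ge] bounds every maximal
   risk below by [d]. *)
apply/eqP; rewrite eq_le; apply/andP; split.
  apply: (@le_trans _ _ n.+2%:R%:E).
    by apply: ge_ereal_sup => _ [theta _ <-]; exact: risk_le.
  by apply: le_ereal_inf_tmp => _ [delta mdelta <-]; exact: max_risk_ge.
by apply: ereal_inf_lbound; exists (multiple_shrinkage f w target).
Unshelve. all: end_near. Qed.
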